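(* Let $(\mathcal{S},\mathcal{A},\boldsymbol{r},\mathcal{U},\boldsymbol{p}_0)$ be a robust MDP with a definable compact sa-rectangular uncertainty set $\mathcal{U}$. Let $(\gamma_t)_{t\in\mathbb{N}}$ be an increasing sequence in $(0,1)$ with $\lim_{t\to+\infty}\gamma_t=1$, and for $t\in\mathbb{N}$ set $\boldsymbol{v}^{t+1}=(1-\gamma_t)\boldsymbol{v}^{\star,\mathcal{U}}_{\gamma_t}$. Let $(\pi^t)_{t\ge1}$ be a sequence of policies such that $\pi^t\in\Pi_{\sf S}$ and $(1-\gamma_{t-1})\boldsymbol{v}^{\pi^t,\mathcal{U}}_{\gamma_{t-1}}=\boldsymbol{v}^t$ for all $t\ge1$. Then $(\boldsymbol{v}^t)_{t\ge1}$ converges to $\boldsymbol{g}^\star\in\mathbb{R}^{\mathcal{S}}$, and $\pi^t$ is average optimal for all $t\in\mathbb{N}$ large enough.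
   Context: A robust MDP (RMDP) is a tuple $(\mathcal{S},\mathcal{A},\boldsymbol{r},\mathcal{U},\boldsymbol{p}_0)$: $\mathcal{S}$ (states) and $\mathcal{A}$ (actions) are finite nonempty sets, $\boldsymbol{r}\in\mathbb{R}^{\mathcal{S}\times\mathcal{A}\times\mathcal{S}}$ is the reward function, the uncertainty set $\mathcal{U}\subset\Delta(\mathcal{S})^{\mathcal{S}\times\mathcal{A}}$ is a nonempty compact set of transition probabilities $\boldsymbol{P}=(\boldsymbol{p}_{sa})_{s,a}$, and $\boldsymbol{p}_0\in\Delta(\mathcal{S})$ is the initial distribution. The set $\mathcal{U}$ is sa-rectangular if $\mathcal{U}=\prod_{(s,a)}\mathcal{U}_{sa}$ with $\mathcal{U}_{sa}\subseteq\Delta(\mathcal{S})$. Definability (in the real exponential field): a subset of $\mathbb{R}^n$ is definable if it is the image, under a canonical projection $\mathbb{R}^{n+k}\to\mathbb{R}^n$ eliminating some set of $k$ variables, of a set of the form $\{\boldsymbol{x}\in\mathbb{R}^{n+k}: Q(x_1,\dots,x_{n+k},\exp(x_1),\dots,\exp(x_{n+k}))=0\}$ with $Q$ a real polynomial in $2(n+k)$ variables. $\mathcal{U}$ is viewed as a subset of $\mathbb{R}^{\mathcal{S}\times\mathcal{A}\times\mathcal{S}}$. $\Pi_{\sf H}$: history-dependent, possibly randomized policies; $\Pi_{\sf S}$: stationary (possibly randomized) policies; $\Pi_{\sf SD}$: stationary deterministic policies. $\mathbb{E}_{\pi,\boldsymbol{P}}$ is expectation with respect to the law of $(s_t,a_t)_{t\ge0}$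 induced by $\pi$ and $\boldsymbol{P}$. For $\gamma\in(0,1)$, $s\in\mathcal{S}$: $v^{\pi,\boldsymbol{P}}_{\gamma,s}=\mathbb{E}_{\pi,\boldsymbol{P}}[\sum_{t\ge0}\gamma^t r_{s_ta_ts_{t+1}}\mid s_0=s]$; the robust value function of $\pi\in\Pi_{\sf S}$ is $v^{\pi,\mathcal{U}}_{\gamma,s}=\min_{\boldsymbol{P}\in\mathcal{U}}v^{\pi,\boldsymbol{P}}_{\gamma,s}$; the optimal robust value function is $v^{\star,\mathcal{U}}_{\gamma,s}=\max_{\pi\in\Pi_{\sf SD}}v^{\pi,\mathcal{U}}_{\gamma,s}$, which is the unique solution $\boldsymbol v$ of $v_s=\max_{a\in\mathcal{A}}\min_{\boldsymbol{p}_{sa}\in\mathcal{U}_{sa}}\boldsymbol{p}_{sa}^\top(\boldsymbol{r}_{sa}+\gamma\boldsymbol{v})$, $s\in\mathcal{S}$ (with $\boldsymbol{r}_{sa}=(r_{sas'})_{s'}$). The optimal gain is $g^\star_s=\max_{\pi\in\Pi_{\sf SD}}\inf_{\boldsymbol{P}\in\mathcal{U}}\lim_{T\to+\infty}\mathbb{E}_{\pi,\boldsymbol{P}}\big[\frac{1}{T+1}\sum_{t=0}^{T}r_{s_ta_ts_{t+1}}\mid s_0=s\big]$. A policy is average optimal if it attains $\sup_{\pi\in\Pi_{\sf H}}\inf_{\boldsymbol{P}\in\mathcal{U}}R_{\sf avg}(\pi,\boldsymbol{P})$, where $R_{\sf avg}(\pi,\boldsymbol{P})=\mathbb{E}_{\pi,\boldsymbol{P}}\big[\limsup_{T\to+\infty}\frac{1}{T+1}\sum_{t=0}^{T}r_{s_ta_ts_{t+1}}\mid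 s_0\sim\boldsymbol{p}_0\big]$. *)

(* Defs.v *)
From HB Require Import structures.
From mathcomp Require Import all_boot all_order all_algebra.
From mathcomp Require Import all_classical all_reals all_analysis.
From mathcomp Require mpoly.

Set Implicit Arguments.
Unset Strict Implicit.
Unset Printing Implicit Defensive.
Import Order.TTheory GRing.Theory Num.Theory.
Import numFieldNormedType.Exports.

Local Open Scope classical_set_scope.
Local Open Scope ring_scope.

(* Nonempty finite sets; the distinguished point is only needed because the
   library's measurable types are pointed. *)
#[short(type="pfinType")]
HB.structure Definition PointedFinite := {T of Finite T & isPointed T}.

HB.instance Definition _ (S A : pfinType) := Pointed.on (S * A)%type.

Definition simplex (R : realType) (T : finType) : set (T -> R) :=
  [set p | (forall x, 0 <= p x) /\ \sum_x p x = 1].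

Section trajectories.
Variables (R : realType) (X : pfinType).

Definition cylinder (x : nat -> X) (n : nat) : set (nat -> X) :=
  [set w | forall i, (i < n)%N -> w i = x i].

Definition cylinders : set (set (nat -> X)) :=
  [set C | exists x n, C = cylinder x n].

(* The product sigma-algebra of the discrete ones on X. *)
Definition traj := g_sigma_algebraType cylinders.

Lemma measurable_cylinder x n : measurable (cylinder x n : set traj).
Proof. by apply: sub_sigma_algebra; exists x, n. Qed.

(* q h y : conditional probability that the next element is y, given that the
   elements seen so far are h. *)
Definition trajectory_law (q : seq X -> X -> R) : set (probability traj R) :=
  [set mu | forall x n,
     mu (cylinder x n) = (\prod_(i < n) q (mkseq x i) (x i))%:E].

Lemma trajectory_law_unique q (mu nu : probability traj R) :
  trajectory_law q mu -> trajectory_law q nu ->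
  forall C : set traj, measurable C -> mu C = nu C.
Proof.
move=> hmu hnu.
pose G : set (set traj) := cylinders `|` [set set0].
have cyl0 x : cylinder x 0 = setT by apply/seteqP; split.
have mG : (measurable : set (set traj)) = <<s G >>.
  apply/seteqP; split.
    by apply: sub_smallest2r; [exact: smallest_sigma_algebra|move=> C ?; left].
  apply: smallest_sub; first exact: sigma_algebra_measurable.
  by move=> C [[x [n ->]]|->]; [exact: measurable_cylinder|exact: measurable0].
have GI : setI_closed G.
  have sub x y m n : (m <= n)%N -> G (cylinder x m `&` cylinder y n).
    move=> mn; have [xy|xy] := pselect (forall i, (i < m)%N -> x i = y i).
      left; exists y, n; apply/seteqP; split=> [w []//|w wy]; split=> // i im.
      by rewrite xy// wy// (leq_trans im).
    right; apply/seteqP; split=> // w [wx wy]; apply: xy => i im.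
    by rewrite -wx// -wy// (leq_trans im).
  move=> _ _ [[x [m ->]]|->] [[y [n ->]]|->]; rewrite ?set0I ?setI0; try by right.
  by have [/sub//|/ltnW/sub] := leqP m n; rewrite setIC.
move=> C mC; apply: (measure_unique G (fun=> setT) mG GI _ _ mu nu) => //.
- by move=> _; left; exists point, 0%N; rewrite cyl0.
- by apply/seteqP; split=> // x _; exists 0%N.
- by move=> _ [[x [n ->]]|->]; [exact: etrans (hmu _ _) (esym (hnu _ _))|rewrite !measure0].
- by move=> _; apply: le_lt_trans (ltry 1); exact: (probability_le1 mu).
Qed.

Section existence.
Variable q : seq X -> X -> R.
Hypothesis qP : forall h, simplex (q h).

(* The sequence h (stored in reverse order) receives the interval
   [lpos h, lpos h + wid h[, split among its one-step extensions. *)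
Let Q h := q (rev h).
Let cum h k := \sum_(y <- take k (enum X)) Q h y.

Let Fixpoint wid (h : seq X) : R :=
  if h is y :: h' then wid h' * Q h' y else 1.
Let Fixpoint lpos (h : seq X) : R :=
  if h is y :: h' then lpos h' + wid h' * cum h' (index y (enum X)) else 0.
Let I h : set R := `[lpos h, lpos h + wid h[%classic.

Let Q_ge0 h y : 0 <= Q h y. Proof. exact: (qP (rev h)).1. Qed.

Let wid_ge0 h : 0 <= wid h.
Proof. by elim: h => //= y h ih; exact: mulr_ge0. Qed.

Let cumS h y :
  cum h (index y (enum X)).+1 = cum h (index y (enum X)) + Q h y.
Proof.
rewrite /cum (take_nth y) ?index_mem ?mem_enum// -cats1 big_cat/= big_seq1.
by rewrite nth_index// mem_enum.
Qed.

Let cum_le h m n : (m <= n)%N -> cum h m <= cum h n.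
Proof.
move=> /subnKC <-; rewrite /cum takeD big_cat/= lerDl.
by apply: sumr_ge0 => y _; exact: Q_ge0.
Qed.

Let cum_ge0 h n : 0 <= cum h n.
Proof. by apply: sumr_ge0 => y _; exact: Q_ge0. Qed.

Let cum_size h : cum h (size (enum X)) = 1.
Proof. by rewrite /cum take_size big_enum/= (qP (rev h)).2. Qed.

Let I_cons y h : I (y :: h) `<=` I h.
Proof.
move=> w; rewrite /I/= !in_itv/= => /andP[wl wr]; apply/andP; split.
  by apply: le_trans wl; rewrite lerDl mulr_ge0.
apply: lt_le_trans wr _; rewrite -addrA lerD2l -mulrDr -cumS.
rewrite -[leRHS]mulr1 ler_wpM2l// -(cum_size h) cum_le// index_mem.
by rewrite mem_enum.
Qed.

Let I_next h w : I h w -> exists y, I (y :: h) w.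
Proof.
rewrite /I/= in_itv/= => /andP[wl wr].
have ex : exists k, w < lpos h + wid h * cum h k.
  by exists (size (enum X)); rewrite cum_size mulr1.
case: (ex_minnP ex) => -[|k] wk kmin.
  by move: wk; rewrite /cum take0 big_nil mulr0 addr0 ltNge wl.
have kX : (k < size (enum X))%N by apply: kmin; rewrite cum_size mulr1.
pose y := nth point (enum X) k; exists y.
have yk : index y (enum X) = k by rewrite index_uniq// enum_uniq.
rewrite /= in_itv/= -addrA -mulrDr -cumS yk wk andbT leNgt.
by apply/negP => /kmin; rewrite ltnn.
Qed.

Let I_inj h y z w : I (y :: h) w -> I (z :: h) w -> y = z.
Proof.
have lt a b : (index a (enum X) < index b (enum X))%N ->
    I (a :: h) w -> I (b :: h) w -> False.
  move=> ab; rewrite /I/= !in_itv/= -!addrA -!mulrDr -!cumS.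
  move=> /andP[_ wa] /andP[wb _].
  have := le_lt_trans wb wa; rewrite ltNge lerD2l ler_wpM2l//.
  exact: cum_le.
move=> Iy Iz; case: (ltngtP (index y (enum X)) (index z (enum X))) => yz.
- by case: (lt _ _ yz Iy Iz).
- by case: (lt _ _ yz Iz Iy).
- by rewrite -(nth_index point (mem_enum X y)) yz nth_index// mem_enum.
Qed.

Let next h w : X := xget point [set y | I (y :: h) w].
Let Fixpoint hist (w : R) n : seq X :=
  if n is n'.+1 then next (hist w n') w :: hist w n' else [::].
Let path (w : R) : traj := fun n => next (hist w n) w.
Let rpath (w : R) : traj := if w \in I [::] then path w else point.

Let histE w n : hist w n = rev (mkseq (path w) n).
Proof. by elim: n => //= n ih; rewrite mkseqS rev_rcons -ih. Qed.

Let I_hist w n : I [::] w -> I (hist w n) w.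
Proof.
move=> w0; elim: n => //= n /I_next [y Iy].
by rewrite /next; case: xgetP => [z _//|/(_ y)].
Qed.

Let I_size h w : I h w -> h = hist w (size h).
Proof.
elim: h => //= y h ih Iyh; rewrite -(ih (I_cons Iyh)); congr cons.
rewrite /next; case: xgetP => [z _ Iz|/(_ y)//].
exact: I_inj Iyh Iz.
Qed.

Let rev_mkseq_inj (x z : nat -> X) n :
  rev (mkseq x n) = rev (mkseq z n) <-> forall i, (i < n)%N -> x i = z i.
Proof.
split=> [/(can_inj revK) e i ni|e].
  by rewrite -(nth_mkseq point x ni) e nth_mkseq.
by congr rev; apply/eq_in_map => i; rewrite mem_iota => /andP[_ /e].
Qed.

Let I_sub0 h : I h `<=` I [::].
Proof. by elim: h => // y h ih; apply: subset_trans ih; exact: I_cons. Qed.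

Let path_cylinder x n : I [::] `&` path @^-1` (cylinder x n) =
  I (rev (mkseq x n)).
Proof.
apply/seteqP; split=> [w [w0 wx]|w Iw].
  have <- : hist w n = rev (mkseq x n) by rewrite histE; apply/rev_mkseq_inj.
  exact: I_hist.
split; first exact: I_sub0 Iw.
move: (I_size Iw); rewrite size_rev size_mkseq histE => /rev_mkseq_inj e i ni.
by rewrite e.
Qed.

Let mI h : measurable (I h). Proof. exact: measurable_itv. Qed.

Let measurable_rpath : measurable_fun setT rpath.
Proof.
apply: (@measurability _ _ R traj setT rpath cylinders erefl).
move=> _ [_ [x [n ->]] <-].
rewrite setTI.
have -> : rpath @^-1` cylinder x n = (I [::] `&` path @^-1` (cylinder x n))
    `|` (~` I [::] `&` [set _ | cylinder x n point]).
  apply/seteqP; split=> w /=; rewrite /rpath.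
    case: ifPn => [/set_mem w0 wx|/negP w0 wx]; first by left.
    by right; split=> // /mem_set.
  by move=> [[w0]|[w0]]; [rewrite mem_set|rewrite memNset].
rewrite path_cylinder; apply: measurableU => //; apply: measurableI.
  exact: measurableC.
by have [?|?] := pselect (cylinder x n point);
  [rewrite (_ : [set _ | _] = setT)|rewrite (_ : [set _ | _] = set0)] => //;
  apply/seteqP; split.
Qed.

Let base := mrestr (@lebesgue_measure R) (mI [::]).
Definition interval_law : set traj -> \bar R := pushforward base rpath.
Local Notation law := interval_law.

Let law0 : law set0 = 0%E. Proof. exact: measure0. Qed.

Let law_ge0 C : (0 <= law C)%E. Proof. exact: measure_ge0. Qed.

Let law_sigma_additive : semi_sigma_additive law.
Proof. exact: measure_semi_sigma_additive. Qed.

HB.instance Definition _ := isMeasure.Build _ _ _ law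
  law0 law_ge0 law_sigma_additive.

Let law_cylinder x n : law (cylinder x n) = (wid (rev (mkseq x n)))%:E.
Proof.
rewrite /interval_law /pushforward /base /mrestr.
have -> : rpath @^-1` cylinder x n `&` I [::] = I (rev (mkseq x n)).
  rewrite -path_cylinder; apply/seteqP; split=> w /=; rewrite /rpath => -[].
    by move=> + w0; rewrite mem_set.
  by move=> w0 ?; rewrite mem_set.
rewrite lebesgue_measure_itv/= lte_fin ltrDl.
case: ltP => [_|w0]; first by rewrite -EFinD addrAC subrr add0r.
by congr EFin; apply/eqP; rewrite eq_le w0 wid_ge0.
Qed.

Let law_setT : law setT = 1%E.
Proof.
have <- : cylinder point 0 = setT by apply/seteqP; split.
by rewrite law_cylinder.
Qed.

HB.instance Definition _ := Measure_isProbability.Build _ _ _ law law_setT.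

Lemma trajectory_law_exists : trajectory_law q !=set0.
Proof.
exists (law : probability traj R) => x n.
apply: etrans (law_cylinder x n) _; congr EFin.
elim: n => [|n ih]; first by rewrite big_ord0.
by rewrite mkseqS rev_rcons/= ih big_ord_recr/= /Q revK.
Qed.

End existence.
End trajectories.

Section definable.
Variable R : realType.

(* Definable sets of the real exponential field. A canonical projection
   R^(n+k) -> R^n keeps, in order, n of the n + k coordinates: it is the
   precomposition with an increasing map f. *)
Definition definable (n : nat) (D : set ('I_n -> R)) : Prop :=
  exists (k : nat) (f : 'I_n -> 'I_(n + k))
         (Q : mpoly.mpoly ((n + k) + (n + k)) R),
    {homo f : i j / (i < j)%N} /\
    D = (fun x => x \o f) @`
      [set x | mpoly.meval (fun i => match fintype.split i with
                                     | inl j => x j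
                                     | inr j => expR (x j)
                                     end) Q = 0].

(* R^I is identified with R^#|I| through the enumeration of I. *)
Definition definable_fin (I : finType) (D : set (I -> R)) : Prop :=
  definable [set x : 'I_#|I| -> R | D (x \o enum_rank)].

End definable.

Section rmdp.
Variables (R : realType) (S A : pfinType).
Implicit Types (r P : S * A * S -> R) (U : set (S * A * S -> R)).

Definition transition : set (S * A * S -> R) :=
  [set P | forall s a, simplex (fun s' => P (s, a, s'))].

Definition sa_rectangular U : Prop :=
  exists Usa : S -> A -> set (S -> R),
    (forall s a, Usa s a `<=` simplex (T := S)) /\
    U = [set P | forall s a, Usa s a (fun s' => P (s, a, s'))].

(* pi h s a : probability of playing a in state s after the past
   h = [:: (s_0, a_0); (s_1, a_1); ...]. *)
Definition hpolicy := seq (S * A) -> S -> A -> R.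
Definition spolicy := S -> A -> R.

Definition history_policy : set hpolicy :=
  [set pi | forall h s, simplex (pi h s)].
Definition stationary_policy : set spolicy := [set pi | forall s, simplex (pi s)].

Definition of_stationary (pi : spolicy) : hpolicy := fun=> pi.
Definition of_deterministic (d : S -> A) : spolicy := fun s a => (a == d s)%:R.

Definition dirac_dist (s : S) : S -> R := fun s' => (s' == s)%:R.

(* Conditional probability of (s_t, a_t) given the past, when s_0 ~ p0. *)
Definition step (p0 : S -> R) (pi : hpolicy) P (h : seq (S * A))
    (y : S * A) : R :=
  (if h is x :: h' then P (last x h', y.1) else p0 y.1) * pi h y.1 y.2.

(* The law of (s_t, a_t)_t (well defined: path_lawP, trajectory_law_unique). *)
Definition path_law (p0 : S -> R) (pi : hpolicy) P
  : probability (traj (S * A)%type) R := get (trajectory_law (step p0 pi P)).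

Lemma step_simplex p0 pi P : simplex p0 -> history_policy pi ->
  transition P -> forall h, simplex (step p0 pi P h).
Proof.
move=> p0P piP PP h.
pose f s := if h is x :: h' then P (last x h', s) else p0 s.
have [f0 f1] : simplex f.
  by case: h @f => [//|x h] f; rewrite /f; case: (last x h) => s a; exact: PP.
split=> [[s a]|]; first exact: mulr_ge0 (f0 s) ((piP h s).1 a).
rewrite (eq_bigr (fun y => f y.1 * pi h y.1 y.2)) => [|[s a] _]//.
rewrite -(pair_bigA _ (fun s a => f s * pi h s a))/= -f1.
by apply: eq_bigr => s _; rewrite -mulr_sumr (piP h s).2 mulr1.
Qed.

Lemma path_lawP p0 pi P : simplex p0 -> history_policy pi -> transition P ->
  trajectory_law (step p0 pi P) (path_law p0 pi P).
Proof.
move=> p0P piP PP; apply: getPex.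
exact/trajectory_law_exists/step_simplex.
Qed.

Definition expect (p0 : S -> R) (pi : hpolicy) P (X : (nat -> S * A) -> R) : R :=
  fine ('E_(path_law p0 pi P)[X])%E.

Definition reward r (w : nat -> S * A) (t : nat) : R := r (w t, (w t.+1).1).

Definition average_reward r (w : nat -> S * A) (T : nat) : R :=
  (T.+1)%:R^-1 * \sum_(0 <= t < T.+1) reward r w t.

(* Conditioning on s_0 = s is starting from the Dirac distribution at s. *)
Definition value r (g : R) (pi : spolicy) P (s : S) : R :=
  expect (dirac_dist s) (of_stationary pi) P
    (fun w => limn (series (fun t => g ^+ t * reward r w t))).

(* Minima over U and maxima over policies are written inf and sup: all the sets
   involved are nonempty and bounded when U is a nonempty set of transitions. *)
Definition robust_value r U (g : R) (pi : spolicy) (s : S) : R :=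
  inf [set value r g pi P s | P in U].

Definition optimal_robust_value r U (g : R) (s : S) : R :=
  sup [set robust_value r U g (of_deterministic d) s | d in [set: S -> A]].

Definition optimal_gain r U (s : S) : R :=
  sup [set inf [set limn (fun T =>
                  expect (dirac_dist s) (of_stationary (of_deterministic d)) P
                    (fun w => average_reward r w T)) | P in U]
      | d in [set: S -> A]].

Definition R_avg r (p0 : S -> R) (pi : hpolicy) P : R :=
  expect p0 pi P (fun w => limn_sup (average_reward r w)).

Definition robust_avg r U (p0 : S -> R) (pi : hpolicy) : R :=
  inf [set R_avg r p0 pi P | P in U].

Definition average_optimal r U (p0 : S -> R) (pi : hpolicy) : Prop :=
  history_policy pi /\
  robust_avg r U p0 pi = sup [set robust_avg r U p0 pi' | pi' in history_policy].

End rmdp.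

(* Main.v *)
Require Import Defs.
From HB Require Import structures.
From mathcomp Require Import all_boot all_order all_algebra.
From mathcomp Require Import all_classical all_reals all_analysis.
From mathcomp Require mpoly.
From mathcomp Require Import measurable_realfun.
From mathcomp Require Import ring lra.

(* Along an ultrafilter on the times [t], finer than the cofinite one, the vectors
   [v t] converge to some [w], the set of pairs (s, a) played by [pi t] is
   constant, and nearly worst transitions [P t] in [U] converge to some [Q] in [U].

   Upper bound. Write [v t = z t + (1 - gamma) h t], where [z t] gathers the terms
   of order larger than [1 - gamma]. The asymptotic sign of [z t - Q z t] at a pair
   (s, a), and the comparison of rewards with [w] when [z t] is preserved, tell
   whether to take the row of [P t] or that of [Q] at (s, a). By rectangularity the
   resulting [P'] is in [U]; it has a superharmonic function [u] close to [w] and a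
   corrector [h] such that [P' (r + h) - h <= u + eps]. Under any history-dependent
   policy, [u] is then a bounded supermartingale with finitely many values, hence is
   eventually constant, and the rewards are at most [u + eps] in the long run.

   Lower bound. A policy is optimal for a discount factor as soon as it only plays
   actions that an optimal policy plays. Hence a stationary policy with the support
   of [pi t] is optimal for discount factors arbitrarily close to 1; as the
   normalized discounted values of a stationary policy against fixed transitions
   tend to its gain, this gain is at least [w] for all transitions in [U].

   So [w] is the optimal gain, whatever the ultrafilter. *)

Set Implicit Arguments.
Unset Strict Implicit.
Unset Printing Implicit Defensive.
Import Order.TTheory GRing.Theory Num.Theory.
Import numFieldNormedType.Exports.

Local Open Scope classical_set_scope.
Local Open Scope ring_scope.

(** * Ultrafilters and asymptotic expansions *)

Section ultrafilters.
Context {T : Type} (F : set_system T) {FU : UltraFilter F}.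

Lemma ultra_decide (P : set T) : (\forall x \near F, P x) \/ (\forall x \near F, ~ P x).
Proof. exact: in_ultra_setVsetC. Qed.

Lemma ultra_fmap (U : Type) (f : T -> U) : UltraFilter (f @ F).
Proof.
split; first exact: fmap_proper_filter.
move=> G GF FG; apply/seteqP; split=> A; last exact: FG.
move=> GA; have [//|nA] := in_ultra_setVsetC (f @^-1` A) FU.
have GnA : G (~` A) by exact: FG.
by have /filter_ex [? []] : G (A `&` ~` A) by exact: filterI.
Qed.

Lemma ultra_fin (I : finType) (f : T -> I) :
  exists i, \forall x \near F, f x = i.
Proof.
apply: contrapT => /forallNP no.
have {}no i : \forall x \near F, f x != i.
  have [/no//|] := ultra_decide [set x | f x = i].
  by apply: filterS => x /= /eqP.
have /filter_ex[x] : \forall x \near F, forall i, f x != i.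
  exact: filter_forall.
by move=> /(_ (f x)); rewrite eqxx.
Qed.

Lemma ultra_cvg_bounded (R : realType) (f : T -> R) (M : R) :
  (\forall x \near F, `|f x| <= M) -> exists l : R, f x @[x --> F] --> l.
Proof.
move=> fM; have : compact (`[- M, M]%classic : set R) by exact: segment_compact.
rewrite compact_ultra => /(_ (f @ F) (ultra_fmap f)) [].
  by apply: filterS fM => x; rewrite /= in_itv/= ler_norml.
by move=> l [_ fl]; exists l.
Qed.

End ultrafilters.
Arguments ultra_decide {T} F {FU} P.
Arguments ultra_fin {T} F {FU I} f.

(** If [P] failed near [F], the trace of [F] on the complement of [P] would be a proper filter, and
    an ultrafilter containing it would be finer than [F] and contain that complement. Limits over
    [\oo] thus reduce to limits along ultrafilters. *)
Lemma near_ultra (T : Type) (F : set_system T) (P : set T) : ProperFilter F ->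
  (forall G, UltraFilter G -> F `<=` G -> \forall x \near G, P x) ->
  \forall x \near F, P x.
Proof.
move=> FF PG; apply: contrapT => nP.
have H : ProperFilter (within (~` P) F).
  apply: Build_ProperFilter_ex => B wB.
  apply: contrapT => /forallNP noB; apply: nP.
  have : \forall x \near F, (~` P) x -> B x by [].
  by apply: filterS => x nB; apply: contrapT => /nB /noB.
have [G [GU FG]] := ultraFilterLemma H.
have GP : G P.
  apply: PG => // A FA; apply: (FG A).
  have : \forall x \near F, A x by [].
  by apply: (@filterS _ F).
have GnP : G (~` P).
  by apply: (FG (~` P)); exact: withinT.
by have /filter_ex[x []] : G (P `&` ~` P) by exact: filterI.
Qed.

Lemma sum_delta (R : pzRingType) (I : finType) (i : I) (c : I -> R) :
  \sum_j (j == i)%:R * c j = c i.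
Proof.
by rewrite (bigD1 i)//= eqxx mul1r big1 ?addr0// => j /negPf ->; rewrite mul0r.
Qed.

Lemma cvg_sumr (R : realType) (T : Type) (F : set_system T) (I : finType)
    (x : I -> T -> R) (y : I -> R) : Filter F ->
  (forall i, x i n @[n --> F] --> y i) ->
  (\sum_i x i n) @[n --> F] --> \sum_i y i.
Proof. by move=> FF xy; apply: cvg_big => //; exact: add_continuous. Qed.

Section expansion.
Context {R : realType} (F : set_system nat) {FU : UltraFilter F}.
Variables (S J : finType) (l : J -> S -> R) (k : nat -> R).
Hypothesis k0 : \forall n \near F, 0 < k n.

Let ev j (x : S -> R) := \sum_s l j s * x s.

(* The remainder [k n * h n s] is of order [k n]; above that order the sign of
   every test is eventually constant, and the corrector [f] has a negative
   value at all the tests that are eventually negative. *)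
Definition expansion_of (x : nat -> S -> R) : Prop :=
  exists (h : nat -> S -> R) (h' f : S -> R),
   (forall s, h n s @[n --> F] --> h' s) /\
   forall j, let z n s := x n s - k n * h n s in
     [\/ (\forall n \near F, ev j (z n) = 0) /\ ev j f = 0,
         forall M, \forall n \near F, M * k n <= ev j (z n) |
         ev j f <= -1].

Let cvg_ev j (x : nat -> S -> R) y :
  (forall s, x n s @[n --> F] --> y s) -> ev j (x n) @[n --> F] --> ev j y.
Proof.
move=> xy; rewrite /ev; apply: cvg_sumr => s.
by apply: cvgM => //; exact: cvg_cst.
Qed.

Let evD j (x y : S -> R) : ev j (fun s => x s + y s) = ev j x + ev j y.
Proof. by rewrite /ev -big_split/=; apply: eq_bigr => s _; rewrite mulrDr. Qed.

Let evZ j (c : R) (x : S -> R) : ev j (fun s => c * x s) = c * ev j x.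
Proof. by rewrite /ev mulr_sumr; apply: eq_bigr => s _; rewrite mulrCA. Qed.

(** Induction on the size of a set [I] outside which [x] vanishes. If [x] is of order [k], [h] is
    [x / k]. Otherwise the largest absolute value [d] of a coordinate exceeds every multiple of [k];
    subtracting [d * y], with [y] the limit of [x / d], cancels a coordinate. A test is decided
    lexicographically: by [y] first, then by the rest. *)
Lemma expansion_exists (x : nat -> S -> R) : expansion_of x.
Proof.
have : forall s, s \notin [set: S]%SET -> \forall n \near F, x n s = 0.
  by move=> s; rewrite inE.
move: [set: S]%SET => I; have [m] := ubnP #|I|; elim: m x I => // m ih x I.
rewrite ltnS => Im xI.
have [[M xM]|unb] := pselect (exists M, \forall n \near F,
    forall s, `|x n s| <= M * k n).
  have lim s : exists y : R, x n s / k n @[n --> F] --> y.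
    apply: (@ultra_cvg_bounded _ _ _ _ _ M).
    near=> n; have kn : 0 < k n by near: n.
    rewrite normrM normfV (gtr0_norm kn) ler_pdivrMr//.
    by move: s; near: n.
  have [h' hh'] := choice lim.
  exists (fun n s => x n s / k n), h', (fun=> 0); split=> // j /=.
  apply: Or31; split; last by rewrite /ev big1// => s _; rewrite mulr0.
  near=> n; have kn : 0 < k n by near: n.
  rewrite /ev big1// => s _.
  by rewrite [k n * _]mulrCA divff ?gt_eqF// mulr1 subrr mulr0.
pose amax n : option S := [pick s | [forall t, `|x n t| <= `|x n s|]].
have amaxP n : (exists s : S, True) -> exists2 s, amax n = Some s &
    forall t, `|x n t| <= `|x n s|.
  move=> [s0 _]; rewrite /amax; case: pickP => [s /forallP ?|]; first by exists s.
  case: (@arg_maxP _ _ _ s0 xpredT (fun s => `|x n s|)) => // s _ smax /(_ s).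
  by move=> /negP[]; apply/forallP => t; exact: smax.
have exS : exists s : S, True.
  apply: contrapT => /forallNP noS; apply: unb; exists 0.
  by apply: nearW => n s; case: (noS s).
have [[i|] Fi] := ultra_fin F amax; last first.
  have /filter_ex[n an] := Fi; have [s sn _] := amaxP n exS.
  by rewrite sn in an.
have {}Fi : \forall n \near F, forall t, `|x n t| <= `|x n i|.
  apply: filterS Fi => n ni; have [s] := amaxP n exS.
  by rewrite ni => -[->].
pose d (n : nat) : R := `|x n i|.
have dk M : \forall n \near F, M * k n < d n.
  have [//|le] := ultra_decide F [set n | M * k n < d n].
  exfalso; apply: unb; exists M; near=> n => s.
  apply: le_trans (_ : d n <= _); first by move: s; near: n.
  by rewrite leNgt; apply/negP; near: n.
have d0 : \forall n \near F, 0 < d n.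
  by apply: filterS (dk 0) => n; rewrite mul0r.
have lim s : exists y : R, x n s / d n @[n --> F] --> y.
  apply: (@ultra_cvg_bounded _ _ _ _ _ 1).
  near=> n; have dn : 0 < d n by near: n.
  rewrite normrM normfV (gtr0_norm dn) ler_pdivrMr// mul1r.
  by move: s; near: n.
have [y xy] := choice lim.
pose x' n s := x n s - d n * y s.
have iI : i \in I.
  apply: contrapT => /negP/xI xi0.
  have /filter_ex[n [dn xi]] : \forall n \near F, 0 < d n /\ x n i = 0.
    exact: filterI.
  by move: dn; rewrite /d xi normr0 ltxx.
(* Coordinate [i] has a constant sign along [F], so [y i] is 1 or -1 and the subtraction cancels
   that coordinate exactly, not only in the limit. *)
have yi : \forall n \near F, x n i = d n * y i.
  have sg (c : R) : (\forall n \near F, x n i = c * d n) ->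
      \forall n \near F, x n i = d n * y i.
    move=> xe; have -> : y i = c.
      apply: (@cvg_unique _ _ (x n i / d n @[n --> F])) => //; first exact: xy.
      apply: cvg_near_cst; near=> n.
      have dn : 0 < d n by near: n.
      have -> : x n i = c * d n by near: n.
      by rewrite mulfK// gt_eqF.
    by apply: filterS xe => n; rewrite mulrC.
  have [pos|neg] := ultra_decide F [set n | 0 <= x n i].
    apply: (sg 1); apply: filterS pos => n /= xn.
    by rewrite mul1r /d ger0_norm.
  apply: (sg (-1)); apply: filterS neg => n /negP; rewrite -ltNge => xn.
  by rewrite /d ltr0_norm// mulN1r opprK.
have [|s|] := ih x' (I :\ i)%SET.
- by rewrite (cardsD1 i) iI in Im.
- rewrite in_setD1 negb_and negbK => /orP[/eqP ->|/xI xs].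
    by apply: filterS yi => n; rewrite /x' => ->; rewrite subrr.
  have -> : x' = fun n s => x n s - d n * y s by [].
  have ys : y s = 0.
    apply: (@cvg_unique _ _ (x n s / d n @[n --> F])) => //; first exact: xy.
    by apply: cvg_near_cst; apply: filterS xs => n ->; rewrite mul0r.
  by apply: filterS xs => n ->; rewrite ys mulr0 subrr.
move=> h [h' [f [hh' dich]]].
(* The multiple [K] of [y] outweighs [f] at every test that is negative on [y]. *)
have [K KP] : exists K : R, forall j, ev j y < 0 -> K * ev j y + ev j f <= -1.
  exists (\sum_j (`|ev j f| + 1) / `|ev j y|) => j yj.
  have : (`|ev j f| + 1) / `|ev j y| <= \sum_j (`|ev j f| + 1) / `|ev j y|.
    by rewrite (bigD1 j)//= lerDl sumr_ge0// => i' _; rewrite divr_ge0.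
  rewrite (ltr0_norm yj) ler_pdivrMr ?oppr_gt0// mulrN.
  have := ler_norm (ev j f); move: (ev j f) (_ * ev j y) => a b; lra.
exists h, h', (fun s => K * y s + f s); split=> // j z.
have evz n : ev j (z n) = d n * ev j y + ev j (fun s => x' n s - k n * h n s).
  by rewrite -evZ -evD; congr ev; apply/funext => s; rewrite /z /x'; ring.
have evf : ev j (fun s => K * y s + f s) = K * ev j y + ev j f by rewrite evD evZ.
case: (ltgtP (ev j y) 0) => yj.
- by apply: Or33; rewrite evf KP.
- apply: Or32 => M.
  (* As [x' / d] tends to 0 and [d] exceeds every multiple of [k], the term [d * ev j y] dominates
     both [x'] and [k * h]. *)
  have x'0 : (ev j (x' n) / d n) @[n --> F] --> (0 : R).
    have -> : (0 : R) = ev j (fun=> 0) by rewrite /ev big1// => s _; rewrite mulr0.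
    under eq_fun do rewrite mulrC -evZ.
    apply: cvg_ev => s.
    have : (x n s / d n - y s) @[n --> F] --> y s - y s.
      by apply: cvgB => //; exact: cvg_cst.
    rewrite subrr; apply: cvg_trans; apply: near_eq_cvg.
    near=> n; have dn : 0 < d n by near: n.
    by rewrite /x' [_^-1 * _]mulrC mulrBl [d n * _]mulrC mulfK// gt_eqF.
  have hM : \forall n \near F, `|ev j (h n)| <= `|ev j h'| + 1.
    have /cvgrPdist_le/(_ 1 ltr01) := @cvg_ev j _ _ hh'.
    apply: filterS => n; have := ler_normD (ev j h') (ev j (h n) - ev j h').
    by rewrite subrKC distrC => ? ?; lra.
  have e0 : 0 < ev j y / 4 by lra.
  have xN : \forall n \near F, `|ev j (x' n) / d n| <= ev j y / 4.
    have /cvgrPdist_le/(_ _ e0) := x'0.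
    by apply: filterS => n; rewrite sub0r normrN.
  near=> n; have dn : 0 < d n by near: n.
  have kn : 0 < k n by near: n.
  rewrite evz (_ : (fun s => _ - _) = (fun s => x' n s + - k n * h n s)); last first.
    by apply/funext => s; rewrite mulNr.
  rewrite evD evZ.
  have xn : `|ev j (x' n) / d n| <= ev j y / 4 by near: n.
  have {}xn : - (ev j y / 4 * d n) <= ev j (x' n).
    by move: xn; rewrite normrM normfV (gtr0_norm dn) ler_pdivrMr// ler_norml => /andP[].
  have hn : k n * ev j (h n) <= k n * (`|ev j h'| + 1).
    rewrite ler_pM2l//; apply: le_trans (ler_norm _) _.
    by near: n.
  have kd : (`|M| + (`|ev j h'| + 1)) * (ev j y / 4)^-1 * k n < d n by near: n; exact: dk.
  have {}kd : (`|M| + (`|ev j h'| + 1)) * k n < ev j y / 4 * d n.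
    by rewrite mulrAC ltr_pdivrMr// [d n * _]mulrC in kd.
  have Mk : M * k n <= `|M| * k n by rewrite ler_pM2r// ler_norm.
  have de : 0 < d n * ev j y by rewrite mulr_gt0//; lra.
  move: Mk kd hn xn de; clear.
  move: (ev j (x' n)) (ev j (h n)) (ev j y) (d n) (k n) `|M| `|ev j h'| => *; lra.
- have := dich j; rewrite evf yj mulr0 add0r; case=> [[z0 f0]|pos|neg].
  + by apply: Or31; split=> //; apply: filterS z0 => n; rewrite evz yj mulr0 add0r.
  + by apply: Or32 => M; apply: filterS (pos M) => n; rewrite evz yj mulr0 add0r.
  + exact: Or33.
Unshelve. all: by end_near.
Qed.

End expansion.

(** * Transitions against which no policy gains *)

Section row_means.
Context {R : realType} {S A : finType}.
Implicit Types (P : S * A * S -> R) (f g : S -> R).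

Definition row_mean P (s : S) (a : A) (f : S -> R) : R :=
  \sum_s' P (s, a, s') * f s'.

Lemma row_meanD P s a f g :
  row_mean P s a (fun s' => f s' + g s') = row_mean P s a f + row_mean P s a g.
Proof. by rewrite /row_mean -big_split; apply: eq_bigr => s' _; rewrite mulrDr. Qed.

Lemma row_meanZ P s a (c : R) f :
  row_mean P s a (fun s' => c * f s') = c * row_mean P s a f.
Proof. by rewrite /row_mean mulr_sumr; apply: eq_bigr => s' _; rewrite mulrCA. Qed.

Lemma row_meanB P s a f g :
  row_mean P s a (fun s' => f s' - g s') = row_mean P s a f - row_mean P s a g.
Proof.
by rewrite /row_mean -sumrB; apply: eq_bigr => s' _; rewrite mulrBr.
Qed.

Lemma cvg_row_mean (F : set_system nat) (P : nat -> S * A * S -> R) Q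
    (x : nat -> S -> R) f s a : Filter F ->
  (forall i, P n i @[n --> F] --> Q i) -> (forall s', x n s' @[n --> F] --> f s') ->
  row_mean (P n) s a (x n) @[n --> F] --> row_mean Q s a f.
Proof. by move=> FF PQ xf; apply: cvg_sumr => s'; exact: cvgM. Qed.

Lemma ler_row_mean P s a f g : (forall s', 0 <= P (s, a, s')) ->
  (forall s', f s' <= g s') -> row_mean P s a f <= row_mean P s a g.
Proof. by move=> P0 fg; apply: ler_sum => s' _; rewrite ler_wpM2l. Qed.

End row_means.

Section certificate.
Context {R : realType} {S A : finType} (F : set_system nat) {FU : UltraFilter F}.
Variables (r : S * A * S -> R) (k e : nat -> R) (P : nat -> S * A * S -> R)
  (Q : S * A * S -> R) (x : nat -> S -> R) (w : S -> R).
Hypothesis k0 : \forall n \near F, 0 < k n.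
Hypothesis kF : k n @[n --> F] --> (0 : R).
Hypothesis eF : e n @[n --> F] --> (0 : R).
Hypothesis PF : forall i, P n i @[n --> F] --> Q i.
Hypothesis xF : forall s, x n s @[n --> F] --> w s.
Hypothesis xP : \forall n \near F, forall s a,
  k n * row_mean (P n) s a (fun s' => r (s, a, s')) +
    (1 - k n) * row_mean (P n) s a (x n) - k n * e n <= x n s.

Let cvg_row (y : nat -> S -> R) f s a : (forall s', y n s' @[n --> F] --> f s') ->
  row_mean (P n) s a (y n) @[n --> F] --> row_mean Q s a f.
Proof. exact: cvg_row_mean. Qed.

Let cvg_row_cst f s a :
  row_mean (P n) s a f @[n --> F] --> row_mean Q s a f.
Proof. by apply: (@cvg_row (fun=> f)) => s'; exact: cvg_cst. Qed.

Let Q_superharmonic s a : row_mean Q s a w <= w s.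
Proof.
apply: (@ler_cvg_to _ F _ _ (fun n => k n * row_mean (P n) s a (fun s' => r (s, a, s')) +
    (1 - k n) * row_mean (P n) s a (x n) - k n * e n) (x ^~ s)).
- have -> : row_mean Q s a w =
      0 * row_mean Q s a (fun s' => r (s, a, s')) + (1 - 0) * row_mean Q s a w - 0 * 0.
    by rewrite subr0 !mul0r mul1r add0r subr0.
  have k1 : (1 - k n) @[n --> F] --> 1 - (0 : R).
    by apply: cvgB kF; exact: cvg_cst.
  apply: cvgB; last exact: cvgM.
  apply: cvgD; first by apply: cvgM; [exact: kF|exact: cvg_row_cst].
  by apply: cvgM; [exact: k1|exact: cvg_row].
- exact: xF.
- by apply: filterS xP => n; exact.
Qed.

(* A row of [P n] is used where it makes [u] drop by an amount of order [k n];
   elsewhere the limit row does not increase [u], and if it preserves [u], its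
   corrected rewards are at most [w] on average. Adding a large multiple of [u]
   to [h] absorbs the rewards wherever [u] drops. *)
Lemma certificate (eps : R) : 0 < eps ->
  exists (n : nat) (b : S -> A -> bool) (u h : S -> R),
  let P' i := if b i.1.1 i.1.2 then P n i else Q i in
  [/\ forall s, `|u s - w s| <= eps,
      forall s a, row_mean P' s a u <= u s &
      forall s a, row_mean P' s a (fun s' => r (s, a, s') + h s') - h s <= u s + eps].
Proof.
move=> eps0; pose d := eps / 2; have d0 : 0 < d by rewrite divr_gt0.
pose test (y : S * A) s' : R := (s' == y.1)%:R - Q (y, s').
have testE s a f : \sum_s' test (s, a) s' * f s' = f s - row_mean Q s a f.
  rewrite /row_mean -[f s](sum_delta s) -sumrB.
  by apply: eq_bigr => s' _; rewrite mulrBl.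
have [h [h' [f [hh' dich]]]] := expansion_exists test k0 x.
(* Limiting advantage of (s, a): the reward corrected by [h'], minus the mean of [w] at the next
   state. *)
pose adv s a := row_mean Q s a (fun s' => r (s, a, s')) + row_mean Q s a h' - h' s
  - row_mean Q s a w.
(* [L] exceeds every [- adv s a] by at least 1: where the test of [f] is at most -1, the term in [f]
   of [u] then outweighs the advantage. *)
pose L := \sum_s \sum_a `|adv s a| + 1.
have Ladv s a : 1 <= adv s a + L.
  have : `|adv s a| <= \sum_s \sum_a `|adv s a|.
    rewrite (bigD1 s)//= (bigD1 a)//= -addrA lerDl addr_ge0//.
      by apply: sumr_ge0 => *.
    by do 2!apply: sumr_ge0 => * .
  by have := ler_norm (- adv s a); rewrite normrN /L; lra.
pose u n s := x n s - k n * h n s - L * k n * f s.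
have uF s : u n s @[n --> F] --> w s.
  have -> : w s = w s - 0 * h' s - L * 0 * f s by rewrite mulr0 !mul0r !subr0.
  apply: cvgB; first by apply: cvgB; [exact: xF|exact: cvgM].
  by apply: cvgM; [apply: cvgM => //|]; exact: cvg_cst.
have bs s a : exists b : bool, \forall n \near F,
    let p := row_mean (if b then P n else Q) s a in
    p (u n) < u n s \/
    p (u n) = u n s /\ p (fun s' => r (s, a, s') + h' s') - h' s <= w s + d.
  (* By [xP], the drop of [u n] under the row of [P n], divided by [k n], is at least a quantity
     that tends to [adv s a - L * (f s - row_mean Q s a f)]. *)
  have Pcase : 0 < adv s a - L * (f s - row_mean Q s a f) ->
      \forall n \near F, row_mean (P n) s a (u n) < u n s.
    move=> pos.
    have : (row_mean (P n) s a (fun s' => r (s, a, s')) - row_mean (P n) s a (x n)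
         - e n - (h n s - row_mean (P n) s a (h n)) - L * (f s - row_mean (P n) s a f))
        @[n --> F] -->
        (row_mean Q s a (fun s' => r (s, a, s')) - row_mean Q s a w - 0 -
        (h' s - row_mean Q s a h') - L * (f s - row_mean Q s a f)).
      have cf : L * (f s - row_mean (P n) s a f) @[n --> F] -->
          L * (f s - row_mean Q s a f).
        apply: cvgM; first exact: cvg_cst.
        by apply: cvgB; [exact: cvg_cst|exact: cvg_row_cst].
      apply: cvgB cf; apply: cvgB; last first.
        by apply: cvgB; [exact: hh'|exact: cvg_row].
      apply: cvgB eF; apply: cvgB; [exact: cvg_row_cst|exact: cvg_row].
    set lm := (X in _ --> X) => cv.
    have lm0 : 0 < lm by move: pos; rewrite /lm /adv; lra.
    have {cv} : \forall n \near F, 0 < row_mean (P n) s a (fun s' => r (s, a, s')) - row_mean (P n) s a (x n)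
         - e n - (h n s - row_mean (P n) s a (h n)) - L * (f s - row_mean (P n) s a f).
      exact: (cvgr_gt lm cv).
    move=> brk; near=> n.
    have kn : 0 < k n by near: n.
    have : 0 < row_mean (P n) s a (fun s' => r (s, a, s')) - row_mean (P n) s a (x n)
         - e n - (h n s - row_mean (P n) s a (h n)) - L * (f s - row_mean (P n) s a f).
      by near: n.
    have /(_ s a) xn : forall s a,
      k n * row_mean (P n) s a (fun s' => r (s, a, s')) +
      (1 - k n) * row_mean (P n) s a (x n) - k n * e n <= x n s by near: n.
    rewrite -(pmulr_rgt0 _ kn) /u !row_meanB !row_meanZ => brk0.
    by move: xn brk0; lra.
  (* If the test vanishes, [Q] preserves [u n]: its row is taken when the advantage is at most [d],
     and otherwise [P n] makes [u n] drop. If the test is of larger order than [k n], [Q] makes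
     [u n] drop. If the test of [f] is at most -1, [P n] does. *)
  have := dich (s, a); rewrite !testE => -[[z0 f0]|zpos|fneg].
  - have [advd|advd] := leP (adv s a) d.
      exists false; apply: filterS z0 => n; rewrite testE => z0; right; split.
        apply/eqP; rewrite -subr_eq0; apply/eqP; move: z0 f0.
        by rewrite /u !row_meanB !row_meanZ; nra.
      have := Q_superharmonic s a; rewrite row_meanD.
      by move: advd; rewrite /adv; lra.
    exists true; apply: filterS (Pcase _) => [n|]; first by left.
    by rewrite f0 mulr0 subr0; exact: lt_trans advd.
  - exists false; near=> n; left.
    have kn : 0 < k n by near: n.
    have : (1 + `|L * (f s - row_mean Q s a f)|) * k n <=
        \sum_s' test (s, a) s' * (x n s' - k n * h n s').
      by near: n; exact: zpos.
    rewrite testE /u !row_meanB !row_meanZ.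
    have : L * (f s - row_mean Q s a f) * k n <=
           `|L * (f s - row_mean Q s a f)| * k n by rewrite ler_pM2r// ler_norm.
    by move: `|_| => N; lra.
  - exists true; apply: filterS (Pcase _) => [n|]; first by left.
    have : L <= - (L * (f s - row_mean Q s a f)).
      rewrite -mulrN -[leLHS]mulr1 ler_wpM2l//; last by lra.
      by rewrite addr_ge0// sumr_ge0// => *; rewrite sumr_ge0.
    by have := Ladv s a; lra.
have {}bs sa : exists b : bool, \forall n \near F,
    let p := row_mean (if b then P n else Q) sa.1 sa.2 in
    p (u n) < u n sa.1 \/
    p (u n) = u n sa.1 /\
    p (fun s' => r (sa, s') + h' s') - h' sa.1 <= w sa.1 + d.
  by case: sa => s a; exact: bs.
have [b bP] := choice bs.
have /filter_ex[n [bn un]] : \forall n \near F, (forall sa,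
    let p := row_mean (if b sa then P n else Q) sa.1 sa.2 in
    p (u n) < u n sa.1 \/
    p (u n) = u n sa.1 /\
    p (fun s' => r (sa, s') + h' s') - h' sa.1 <= w sa.1 + d) /\
    forall s, `|u n s - w s| <= d.
  apply: filterI; first exact: filter_forall.
  apply: filter_forall => s; have /cvgrPdist_le/(_ _ d0) := uF s.
  by apply: filterS => n; rewrite distrC.
pose P' i := if b i.1 then P n i else Q i.
have P'E s a g : row_mean P' s a g = row_mean (if b (s, a) then P n else Q) s a g.
  by rewrite /row_mean /P'/=; case: ifP.
pose gap s a := row_mean P' s a (fun s' => r (s, a, s') + h' s') - h' s - u n s.
(* Pairs where [u n] is preserved contribute 0, the inverse of 0 being 0; where [u n] drops, [K]
   times the drop covers [gap]. *)
pose K := \sum_s \sum_a `|gap s a| / `|u n s - row_mean P' s a (u n)|.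
have Kgap s a : row_mean P' s a (u n) < u n s ->
    gap s a <= K * (u n s - row_mean P' s a (u n)).
  rewrite -subr_gt0 => drop; rewrite -ler_pdivrMr//.
  apply: le_trans (_ : `|gap s a| / `|u n s - row_mean P' s a (u n)| <= _).
    by rewrite (gtr0_norm drop) ler_pM2r ?invr_gt0// ler_norm.
  rewrite /K (bigD1 s)//= (bigD1 a)//= -[leRHS]addrA lerDl addr_ge0//.
    by apply: sumr_ge0 => *; rewrite divr_ge0.
  by do 2!apply: sumr_ge0 => *; rewrite divr_ge0.
exists n, (fun s a => b (s, a)), (u n), (fun s => h' s + K * u n s).
move=> P0; have -> : P0 = P' by apply/funext => -[[s a] s'].
split=> [s|s a|s a].
- by apply: le_trans (un s) _; rewrite /d; lra.
- by rewrite P'E; case: (bn (s, a)) => [/ltW//|[->]].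
- have := un s; rewrite ler_norml => /andP[un1 un2].
  have -> : row_mean P' s a (fun s' => r (s, a, s') + (h' s' + K * u n s')) -
     (h' s + K * u n s) = gap s a - K * (u n s - row_mean P' s a (u n)) + u n s.
    under eq_fun do rewrite addrA.
    by rewrite row_meanD row_meanZ /gap; ring.
  have := bn (s, a); rewrite /= -!P'E => -[/Kgap|[ue]]; first by lra.
  by rewrite ue subrr mulr0 subr0 /gap /d in un1 un2 *; lra.
Unshelve. all: by end_near.
Qed.

End certificate.

(** * Stochastic kernels and trajectories *)

Section stochastic_kernel.
Context {R : realType} {S : finType}.
Variable M : S -> S -> R.
Hypothesis MP : forall s, simplex (M s).

Definition kmean (f : S -> R) (s : S) : R := \sum_s' M s s' * f s'.

Lemma kmeanD f g s : kmean (fun t => f t + g t) s = kmean f s + kmean g s.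
Proof. by rewrite /kmean -big_split; apply: eq_bigr => t _; rewrite mulrDr. Qed.

Lemma kmeanB f g s : kmean (fun t => f t - g t) s = kmean f s - kmean g s.
Proof. by rewrite /kmean -sumrB; apply: eq_bigr => t _; rewrite mulrBr. Qed.

Lemma kmeanZ c f s : kmean (fun t => c * f t) s = c * kmean f s.
Proof. by rewrite /kmean mulr_sumr; apply: eq_bigr => t _; rewrite mulrCA. Qed.

Lemma ler_kmean f g s : (forall t, f t <= g t) -> kmean f s <= kmean g s.
Proof. by move=> fg; apply: ler_sum => t _; rewrite ler_wpM2l// (MP s).1. Qed.

Lemma kmean_cst c s : kmean (fun=> c) s = c.
Proof. by rewrite /kmean -mulr_suml (MP s).2 mul1r. Qed.

Lemma ler_iter_kmean t f g : (forall s, f s <= g s) ->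
  forall s, iter t kmean f s <= iter t kmean g s.
Proof. by move=> fg; elim: t => //= t ih s; exact: ler_kmean. Qed.

Lemma iter_kmean_cst t c s : iter t kmean (fun=> c) s = c.
Proof.
elim: t s => //= t ih s; rewrite -[RHS](kmean_cst c s).
by congr kmean; apply/funext.
Qed.

Lemma iter_kmeanD t f g s :
  iter t kmean (fun u => f u + g u) s = iter t kmean f s + iter t kmean g s.
Proof.
elim: t s => //= t ih s; rewrite -kmeanD; congr kmean; exact/funext.
Qed.

Lemma iter_kmeanZ t c f s :
  iter t kmean (fun u => c * f u) s = c * iter t kmean f s.
Proof.
elim: t s => //= t ih s; rewrite -kmeanZ; congr kmean; exact/funext.
Qed.

Lemma iter_kmean_norm t f B s : (forall u, `|f u| <= B) ->
  `|iter t kmean f s| <= B.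
Proof.
move=> fB; rewrite ler_norml; apply/andP; split.
  rewrite -(iter_kmean_cst t (- B) s); apply: ler_iter_kmean => u.
  by have := fB u; rewrite ler_norml => /andP[].
rewrite -(iter_kmean_cst t B s); apply: ler_iter_kmean => u.
exact: le_trans (ler_norm _) (fB u).
Qed.

Lemma finfun_bounded (f : S -> R) : exists2 B : R, 0 <= B & forall s, `|f s| <= B.
Proof.
exists (\sum_s `|f s|); first exact: sumr_ge0.
by move=> s; rewrite (bigD1 s)//= lerDl sumr_ge0.
Qed.

(* The powers of the kernel are bounded, so that the kernel and the range of
   [id - kmean] meet trivially. *)
Lemma invariant_coboundary_eq0 k y :
  (forall s, kmean k s = k s) -> (forall s, k s = y s - kmean y s) ->
  forall s, k s = 0.
Proof.
move=> kk ky s.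
have it t u : iter t kmean y u = y u - t%:R * k u.
  elim: t u => [|t ih] u /=; first by rewrite mul0r subr0.
  have -> : iter t kmean y = fun u => y u - t%:R * k u by apply/funext.
  by rewrite kmeanB kmeanZ kk -natr1 ky; ring.
have [B B0 yB] := finfun_bounded y.
apply/eqP; apply: contrapT => /negP k0.
have kpos : 0 < `|k s| by rewrite normr_gt0.
have [t tB] : exists t : nat, 2 * B / `|k s| < t%:R.
  by exists (Num.truncn (2 * B / `|k s|)).+1; apply: truncnS_gt.
move: tB; rewrite ltr_pdivrMr// => tB.
have : t%:R * `|k s| <= 2 * B.
  rewrite -[t%:R]ger0_norm// -normrM.
  have -> : t%:R * k s = y s - iter t kmean y s by rewrite it; ring.
  apply: le_trans (ler_normB _ _) _.
  by rewrite mulr2n mulrDl !mul1r lerD// iter_kmean_norm.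
by rewrite leNgt tB.
Qed.

(** The kernel and the range of [id - kmean] meet only in 0 by the previous lemma, so by rank they
    span all functions, and [c] splits along them. When [c] is the reward of a chain, [k] is its
    gain and [y] solves the Poisson equation. *)
Lemma mean_ergodic (c : S -> R) : exists k y : S -> R,
  (forall s, kmean k s = k s) /\ (forall s, c s = k s + y s - kmean y s).
Proof.
pose n := #|S|.
pose vec (f : S -> R) : 'rV[R]_n := \row_j f (enum_val j).
pose fn (v : 'rV[R]_n) s : R := v ord0 (enum_rank s).
pose B : 'M[R]_n := 1%:M - \matrix_(i, j) M (enum_val j) (enum_val i).
have BE v s : fn (v *m B) s = fn v s - kmean (fn v) s.
  rewrite /fn mulmxBr mulmx1 !mxE; congr (_ - _).
  rewrite /kmean (reindex_onto enum_rank enum_val) => [|i _]; last exact: enum_valK.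
  rewrite (eq_bigl xpredT) => [|t]; last by rewrite enum_rankK eqxx.
  by apply: eq_bigr => t _; rewrite !mxE !enum_rankK mulrC.
have cap0 : (kermx B :&: B)%MS = 0.
  apply/eqP/rowV0P => v; rewrite sub_capmx => /andP[/sub_kermxP vB /submxP[y vy]].
  have fn0 s : fn v s = 0.
    apply: (@invariant_coboundary_eq0 (fn v) (fn y)) => u.
      have := BE v u; rewrite vB /fn mxE => /esym/eqP.
      by rewrite subr_eq0 => /eqP <-.
    by rewrite vy BE.
  apply/rowP => j; have := fn0 (enum_val j).
  by rewrite /fn enum_valK mxE.
have full : row_full (kermx B + B)%MS.
  rewrite /row_full; have := mxrank_sum_cap (kermx B) B.
  by rewrite cap0 mxrank0 addn0 mxrank_ker subnK ?rank_leq_row// => ->.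
have /sub_addsmxP[[u1 u2] /= cu] := submx_full (vec c) full.
exists (fn (u1 *m kermx B)), (fn u2); split=> s.
  have := BE (u1 *m kermx B) s; rewrite -mulmxA mulmx_ker mulmx0 /fn mxE => /esym/eqP.
  by rewrite subr_eq0 => /eqP <-.
rewrite -addrA -BE.
have -> : c s = fn (vec c) s by rewrite /fn mxE enum_rankK.
by rewrite cu /fn !mxE.
Qed.

End stochastic_kernel.

(** * Expectations of bounded measurable functions *)

Section bounded_expectation.
Context {d : measure_display} {T : measurableType d} {R : realType}.
Variable P : probability T R.
Implicit Types X Y : T -> R.

(** Such functions are integrable for a probability, so that the real number [fine] of their
    expectation is linear and monotone. *)
Definition bmfun X : Prop :=
  measurable_fun setT X /\ exists B, forall w, `|X w| <= B.

Local Notation E X := (fine (expectation P X)).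

Lemma bmfun_integrable X : bmfun X -> P.-integrable setT (EFin \o X).
Proof.
move=> [mX [B XB]]; apply: measurable_bounded_integrable => //.
  exact: le_lt_trans (probability_le1 P measurableT) (ltry 1).
exists B; split; first exact: num_real.
by move=> M BM w _; apply: le_trans (XB w) (ltW BM).
Qed.

Lemma bmfun_cst c : bmfun (fun=> c).
Proof. by split; [exact: measurable_cst|exists `|c|]. Qed.

Lemma bmfunD X Y : bmfun X -> bmfun Y -> bmfun (fun w => X w + Y w).
Proof.
move=> [mX [B XB]] [mY [C YC]]; split; first exact: measurable_funD.
by exists (B + C) => w; apply: le_trans (ler_normD _ _) _; exact: lerD.
Qed.

Lemma bmfunZ c X : bmfun X -> bmfun (fun w => c * X w).
Proof.
move=> [mX [B XB]]; split; first by apply: measurable_funM => //; exact: measurable_cst.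
by exists (`|c| * B) => w; rewrite normrM ler_wpM2l.
Qed.

Lemma bmfun_sum (I : finType) (X : I -> T -> R) :
  (forall i, bmfun (X i)) -> bmfun (fun w => \sum_i X i w).
Proof.
move=> bX; rewrite (_ : (fun _ => _) = \sum_i X i); last first.
  by apply/funext => w; rewrite fct_sumE.
apply: big_ind => [|Y Z|i _]; [exact: bmfun_cst|exact: bmfunD|exact: bX].
Qed.

Lemma bmfun_indic (A : set T) : measurable A -> bmfun \1_A.
Proof.
move=> mA; split; first exact: measurable_indic.
by exists 1 => w; rewrite indicE; case: (_ \in _); rewrite ?normr1 ?normr0.
Qed.

Lemma mean_cst c : E (fun=> c) = c.
Proof. by rewrite -[fun=> c]/(cst c) expectation_cst. Qed.

Lemma meanD X Y : bmfun X -> bmfun Y -> E (fun w => X w + Y w) = E X + E Y.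
Proof.
move=> bX bY; rewrite unlock.
by have := @RintegralD _ _ _ P _ X Y measurableT (bmfun_integrable bX) (bmfun_integrable bY).
Qed.

Lemma meanZ c X : bmfun X -> E (fun w => c * X w) = c * E X.
Proof.
move=> bX; rewrite unlock.
by have := @RintegralZl _ _ _ P _ X c measurableT (bmfun_integrable bX).
Qed.

Lemma ler_mean X Y : bmfun X -> bmfun Y -> (forall w, X w <= Y w) -> E X <= E Y.
Proof.
move=> bX bY XY; rewrite unlock.
have := @le_Rintegral _ _ _ P _ X Y measurableT (bmfun_integrable bX) (bmfun_integrable bY).
by apply => w _.
Qed.

Lemma mean_sum (I : finType) (X : I -> T -> R) : (forall i, bmfun (X i)) ->
  E (fun w => \sum_i X i w) = \sum_i E (X i).
Proof.
move=> bX; rewrite (_ : (fun _ => _) = \sum_i X i); last first.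
  by apply/funext => w; rewrite fct_sumE.
suff [] : bmfun (\sum_i X i) /\ E (\sum_i X i) = \sum_i E (X i) by [].
apply: (big_ind2 (fun Y y => bmfun Y /\ E Y = y)).
- by split; [exact: bmfun_cst|exact: mean_cst].
- by move=> Y y Z z [bY <-] [bZ <-]; split; [exact: bmfunD|exact: meanD].
- by move=> i _; split.
Qed.

Lemma mean_indic (A : set T) : measurable A -> E \1_A = fine (P A).
Proof. by move=> mA; rewrite expectation_indic. Qed.

Lemma mean_cvg (Xn : nat -> T -> R) X B : (forall n, measurable_fun setT (Xn n)) ->
  (forall n w, `|Xn n w| <= B) -> (forall w, Xn n w @[n --> \oo] --> X w) ->
  E (Xn n) @[n --> \oo] --> E X.
Proof.
move=> mXn XnB XnX.
have XB w : `|X w| <= B.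
  have : `|Xn n w| @[n --> \oo] --> `|X w| by apply: cvg_norm; exact: XnX.
  by move/cvgr_to_le; apply; apply: nearW => n; exact: XnB.
have mX : measurable_fun setT X.
  by apply: (@measurable_fun_cvg _ _ _ _ Xn) => // w _; exact: XnX.
have bX : bmfun X by split=> //; exists B.
have bXn n : bmfun (Xn n) by split=> //; exists B.
rewrite unlock; apply: fine_cvg; rewrite fineK; last first.
  exact: (integrable_fin_num measurableT (bmfun_integrable bX)).
apply: (@dominated_cvg _ _ _ P setT measurableT (fun n => EFin \o Xn n) (EFin \o X)
  (fun=> B%:E)) => //=.
- by move=> n; apply/measurable_EFinP; exact: mXn.
- by move=> w _; apply: cvg_EFin => //; [exact: nearW|exact: XnX].
- exact: (bmfun_integrable (bmfun_cst B)).
- by move=> n w _; rewrite lee_fin.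
Qed.

End bounded_expectation.

(** * Trajectory laws as iterated finite sums *)

Section trajectory_means.
Context {R : realType} {X : pfinType}.
Variable q : seq X -> X -> R.

(** Expectation of a function of the first [n] elements, by [prefix_mean]. The sum over the last
    element is innermost, so that unfolding once conditions on all the earlier ones. *)
Fixpoint hmean (n : nat) (f : seq X -> R) : R :=
  if n is n'.+1 then hmean n' (fun h => \sum_y q h y * f (rcons h y))
  else f [::].

Lemma eq_hmean n f g : (forall h, size h = n -> f h = g h) -> hmean n f = hmean n g.
Proof.
elim: n f g => [|n ih] f g fg /=; first exact: fg.
apply: ih => h hn; apply: eq_bigr => y _; rewrite fg//.
by rewrite size_rcons hn.
Qed.

Lemma hmeanZ n c f : hmean n (fun h => c * f h) = c * hmean n f.
Proof.
elim: n f => //= n ih f; rewrite -ih; apply: eq_hmean => h _.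
by rewrite mulr_sumr; apply: eq_bigr => y _; rewrite mulrCA.
Qed.

Lemma hmean_sum (I : finType) n (f : I -> seq X -> R) :
  hmean n (fun h => \sum_i f i h) = \sum_i hmean n (f i).
Proof.
elim: n f => //= n ih f; rewrite -ih; apply: eq_hmean => h _.
by rewrite exchange_big; apply: eq_bigr => y _; rewrite mulr_sumr.
Qed.

Lemma hmean_path n (x : nat -> X) :
  hmean n (fun h => (h == mkseq x n)%:R) = \prod_(i < n) q (mkseq x i) (x i).
Proof.
elim: n => [|n ih] /=; first by rewrite big_ord0.
rewrite big_ord_recr/= -ih mulrC -hmeanZ; apply: eq_hmean => h hn.
rewrite (bigD1 (x n))//= big1 ?addr0 => [|y yx]; last first.
  by rewrite mkseqS eqseq_rcons (negPf yx) andbF mulr0.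
by rewrite mkseqS eqseq_rcons eqxx andbT; case: eqP => [->|]; rewrite ?mulr1 ?mulr0.
Qed.

Variable mu : probability (traj X) R.
Hypothesis muP : trajectory_law q mu.

Let path_set n (h : n.-tuple X) : set (traj X) := cylinder (nth point h) n.

Let path_setP n (h : n.-tuple X) w : path_set h w <-> mkseq w n = h.
Proof.
split=> [hw|e i ni].
  rewrite -[RHS](mkseq_nth point) size_tuple; apply/eq_in_map => i.
  by rewrite mem_iota => /andP[_ /hw].
by rewrite -e nth_mkseq.
Qed.

Let prefix_sum n (f : seq X -> R) (w : traj X) :
  f (mkseq w n) = \sum_(h : n.-tuple X) f h * \1_(path_set h) w.
Proof.
have sz : size (mkseq w n) == n by rewrite size_mkseq.
rewrite (bigD1 (Tuple sz))//= big1 => [|h hw].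
  by rewrite addr0 indicE mem_set ?mulr1//; exact/path_setP.
rewrite indicE memNset ?mulr0// => /path_setP wh; move: hw => /eqP; apply.
exact/val_inj.
Qed.

Lemma prefix_bmfun n (f : seq X -> R) : bmfun (fun w : traj X => f (mkseq w n)).
Proof.
rewrite (_ : (fun _ => _) = fun w => \sum_(h : n.-tuple X) f h * \1_(path_set h) w).
  apply: bmfun_sum => h; apply/bmfunZ/bmfun_indic; exact: measurable_cylinder.
by apply/funext => w; exact: prefix_sum.
Qed.

(** The function is a finite combination of indicators of cylinders, whose masses are prescribed by
    [trajectory_law] and turned into iterated sums by [hmean_path]. *)
Lemma prefix_mean n (f : seq X -> R) :
  fine (expectation mu (fun w : traj X => f (mkseq w n))) = hmean n f.
Proof.
rewrite (_ : (fun _ => _) = fun w => \sum_(h : n.-tuple X) f h * \1_(path_set h) w); last first.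
  by apply/funext => w; exact: prefix_sum.
have mC h : measurable (@path_set n h) by exact: measurable_cylinder.
rewrite mean_sum => [|h]; last exact/bmfunZ/bmfun_indic.
transitivity (\sum_(h : n.-tuple X) f h * hmean n (fun l => (l == h)%:R)).
  apply: eq_bigr => h _; rewrite meanZ ?mean_indic//; last exact: bmfun_indic.
  have := muP (nth point h) n; rewrite /path_set => ->; congr (_ * _).
  rewrite /= -hmean_path; apply: eq_hmean => l _.
  by rewrite -{2}(size_tuple h) mkseq_nth.
under eq_bigr do rewrite -hmeanZ.
rewrite -hmean_sum; apply: eq_hmean => l ln.
have sz : size l == n by rewrite ln.
rewrite (bigD1 (Tuple sz))//= eqxx mulr1 big1 ?addr0// => h hl.
case: eqP => [lh|]; last by rewrite mulr0.
by move: hl => /eqP[]; exact/val_inj.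
Qed.

End trajectory_means.

(** * Average and discounted rewards of a trajectory *)

Lemma cvgn_dominated_geometric (R : realType) (u : nat -> R) (B g : R) :
  0 <= g < 1 -> (forall t, `|u t| <= B) -> cvgn (series (fun t => g ^+ t * u t)).
Proof.
move=> /andP[g0 g1] uB; apply: normed_cvg.
apply: (@series_le_cvg _ _ (geometric B g)) => [n|n|n|].
- exact: normr_ge0.
- by rewrite /geometric/= mulr_ge0 ?exprn_ge0// (le_trans _ (uB 0%N)).
- by rewrite /geometric/= normrM ger0_norm ?exprn_ge0// mulrC ler_wpM2r ?exprn_ge0.
- by apply: is_cvg_geometric_series; rewrite ger0_norm.
Qed.

Lemma limn_sup_bounds (R : realType) (u : nat -> R) B : (forall n, `|u n| <= B) ->
  [/\ sups u n @[n --> \oo] --> limn_sup u, forall n, u n <= sups u n &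
      forall n c, (forall m, (n <= m)%N -> u m <= c) -> sups u n <= c].
Proof.
move=> uB.
have ub : has_ubound (range u).
  by exists B => _ [n _ <-]; exact: le_trans (ler_norm _) (uB n).
have lb : has_lbound (range u).
  by exists (- B) => _ [n _ <-]; have := uB n; rewrite ler_norml => /andP[].
split.
- have := cvg_sups_inf ub lb; rewrite /limn_sup => c.
  by move/cvg_lim : (c) => ->.
- move=> n; apply: ub_le_sup; last by exists n => /=.
  exact: has_ubound_sdrop.
- move=> n c uc; apply: ge_sup; first by exists (u n); exists n => /=.
  by move=> _ [m /= nm <-]; exact: uc.
Qed.

Lemma sups_norm (R : realType) (u : nat -> R) B n : (forall n, `|u n| <= B) ->
  `|sups u n| <= B.
Proof.
move=> uB; have [_ le ge] := limn_sup_bounds uB; rewrite ler_norml; apply/andP; split.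
  by apply: le_trans (le n); have := uB n; rewrite ler_norml => /andP[].
by apply: ge => m _; apply: le_trans (ler_norm _) (uB m).
Qed.

Section functionals.
Context {R : realType} {S A : pfinType}.
Variable r : S * A * S -> R.
Local Notation X := (S * A)%type.

(** The reward at time [t] also reads the state at time [t + 1], so it is a function of the first
    [t + 2] elements. *)
Definition hreward (h : seq X) t : R := r (nth point h t, (nth point h t.+1).1).

Lemma rewardE (w : nat -> X) n t : (t.+1 < n)%N ->
  reward r w t = hreward (mkseq w n) t.
Proof. by move=> tn; rewrite /hreward !nth_mkseq// ltnW. Qed.

Variable B : R.
Hypothesis rB : forall i, `|r i| <= B.
Variable mu : probability (traj X) R.

Lemma reward_bmfun t : bmfun (fun w : traj X => reward r w t).
Proof.
rewrite (_ : (fun _ => _) = fun w => hreward (mkseq w t.+2) t); last first.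
  by apply/funext => w; rewrite -rewardE.
exact: (prefix_bmfun t.+2 (fun h => hreward h t)).
Qed.

Lemma average_reward_norm w T : `|average_reward r w T| <= B.
Proof.
rewrite /average_reward normrM normfV normr_nat ler_pdivrMl ?ltr0n//.
apply: le_trans (ler_norm_sum _ _ _) _.
apply: le_trans (ler_sum _ (fun t _ => rB _)) _.
by rewrite big_mkord sumr_const card_ord mulr_natl.
Qed.

Lemma average_reward_bmfun T : bmfun (fun w : traj X => average_reward r w T).
Proof.
rewrite /average_reward.
apply: (@bmfunZ _ (traj X) _ _ (fun w => \sum_(0 <= t < T.+1) reward r w t)).
rewrite (_ : (fun _ => _) = fun w => \sum_(t < T.+1) reward r w t); last first.
  by apply/funext => w; rewrite big_mkord.
by apply: (@bmfun_sum _ (traj X) _ _ (fun (t : 'I_T.+1) w => reward r w t)) => t; exact: reward_bmfun.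
Qed.

Lemma average_sups_bmfun n :
  bmfun (fun w : traj X => sups (average_reward r w) n).
Proof.
split; last by exists B => w; apply: sups_norm => m; exact: average_reward_norm.
apply: (@measurable_fun_sups _ (traj X) R setT (fun T w => average_reward r w T)) => [w _|m].
  by exists B => _ [m _ <-]; exact: le_trans (ler_norm _) (average_reward_norm w m).
by have [] := average_reward_bmfun m.
Qed.

(** Bounded convergence along the tail suprema; it carries bounds on expected averages over to the
    expected limit superior. *)
Lemma average_limsup_cvg :
  fine (expectation mu (fun w => sups (average_reward r w) n)) @[n --> \oo] -->
  fine (expectation mu (fun w => limn_sup (average_reward r w))).
Proof.
apply: (@mean_cvg _ (traj X) R _ (fun n w => sups (average_reward r w) n) _ B) => [n|n w|w].
- by have [] := average_sups_bmfun n.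
- by apply: sups_norm => m; exact: average_reward_norm.
- by have [] := limn_sup_bounds (average_reward_norm w).
Qed.

Lemma average_limsup_bmfun : bmfun (fun w : traj X => limn_sup (average_reward r w)).
Proof.
have cv (w : traj X) : sups (average_reward r w) n @[n --> \oo] -->
    limn_sup (average_reward r w).
  by have [] := limn_sup_bounds (average_reward_norm w).
split.
  apply: (@measurable_fun_cvg _ (traj X) R setT (fun n w => sups (average_reward r w) n)) => //.
  by move=> n; have [] := average_sups_bmfun n.
exists B => w; have /cvg_norm/cvgr_to_le := cv w; apply.
by apply: nearW => n; apply: sups_norm => m; exact: average_reward_norm.
Qed.

(** Expectation and discounted sum are exchanged by bounded convergence, the partial sums being at
    most [B / (1 - g)] in absolute value. *)
Lemma discounted_cvg g : 0 <= g < 1 ->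
  \sum_(t < n) g ^+ t * fine (expectation mu (fun w => reward r w t)) @[n --> \oo] -->
  fine (expectation mu (fun w => limn (series (fun t => g ^+ t * reward r w t)))).
Proof.
move=> g01; have /andP[g0 g1] := g01.
have br (t : nat) : bmfun (fun w : traj X => g ^+ t * reward r w t).
  exact/bmfunZ/reward_bmfun.
have bs n : bmfun (fun w : traj X => series (fun t => g ^+ t * reward r w t) n).
  rewrite (_ : (fun _ => _) = fun w => \sum_(t < n) g ^+ t * reward r w t).
    by apply: (@bmfun_sum _ (traj X) _ _ (fun (t : 'I_n) w => g ^+ t * reward r w t)).
  by apply/funext => w; rewrite /series/= big_mkord.
rewrite (_ : (fun n => _) = fun n => fine (expectation mu
    (fun w => series (fun t => g ^+ t * reward r w t) n))); last first.
  apply/funext => n; transitivity (fine (expectation mu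
      (fun w => \sum_(t < n) g ^+ t * reward r w t))).
    rewrite (@mean_sum _ (traj X) _ _ _ (fun (t : 'I_n) w => g ^+ t * reward r w t))//.
    by apply: eq_bigr => t _; rewrite -meanZ//; exact: reward_bmfun.
  congr (fine (expectation _ _)).
  by apply/funext => w; rewrite /series/= big_mkord.
apply: (@mean_cvg _ (traj X) R _ (fun n w => series (fun t => g ^+ t * reward r w t) n) _
  (B / (1 - g))) => [n|n w|w].
- by have [] := bs n.
- have B0 : 0 <= B by apply: le_trans (rB point).
  rewrite /series/=; apply: le_trans (ler_norm_sum _ _ _) _.
  apply: (@le_trans _ _ (\sum_(0 <= t < n) g ^+ t * B)).
    apply: ler_sum => t _; rewrite normrM ger0_norm ?exprn_ge0//.
    by rewrite ler_wpM2l ?exprn_ge0//; exact: rB.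
  rewrite -mulr_suml mulrC ler_wpM2l//.
  have := @geometric_seriesE _ 1 g (negbT (lt_eqF g1)).
  move=> /(congr1 (fun f => f n)); rewrite /series/=.
  under eq_bigr do rewrite mul1r.
  move=> ->; rewrite mul1r ler_pdivrMr ?subr_gt0// mulVf ?gt_eqF ?subr_gt0//.
  by rewrite gerBl exprn_ge0.
- by apply: (@cvgn_dominated_geometric _ _ B) => // t; exact: rB.
Qed.

End functionals.

(** * Stationary policies *)

Section one_step.
Context {R : realType} {S A : pfinType}.
Variables (p0 : S -> R) (pi : hpolicy R S A) (P : S * A * S -> R).
Local Notation X := (S * A)%type.

Lemma step_first (f : X -> R) :
  \sum_y step p0 pi P [::] y * f y = \sum_s p0 s * \sum_a pi [::] s a * f (s, a).
Proof.
under [RHS]eq_bigr do rewrite mulr_sumr.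
rewrite pair_bigA/=; apply: eq_bigr => -[s a] _.
by rewrite /step/= mulrA.
Qed.

Lemma step_next (h : seq X) (f : X -> R) : (0 < size h)%N ->
  \sum_y step p0 pi P h y * f y =
  \sum_s P (last point h, s) * \sum_a pi h s a * f (s, a).
Proof.
case: h => // x h _; under [RHS]eq_bigr do rewrite mulr_sumr.
rewrite pair_bigA/=; apply: eq_bigr => -[s a] _.
by rewrite /step/= mulrA.
Qed.

Lemma step_next_state (h : seq X) (f : S -> R) : history_policy pi ->
  (0 < size h)%N ->
  \sum_y step p0 pi P h y * f y.1 =
  row_mean P (last point h).1 (last point h).2 f.
Proof.
move=> piP h0; rewrite (@step_next _ (fun y => f y.1))// /row_mean.
apply: eq_bigr => s _ /=; rewrite -mulr_suml (piP h s).2 mul1r.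
by case: (last point h).
Qed.

Lemma step_first_state (f : S -> R) : history_policy pi ->
  \sum_y step p0 pi P [::] y * f y.1 = \sum_s p0 s * f s.
Proof.
move=> piP; rewrite (step_first (fun y => f y.1)).
by apply: eq_bigr => s _ /=; rewrite -mulr_suml (piP _ s).2 mul1r.
Qed.

End one_step.

Section stationary.
Context {R : realType} {S A : pfinType}.
Variables (r : S * A * S -> R) (p0 : S -> R) (pi : spolicy R S A) (P : S * A * S -> R).
Hypothesis p0P : simplex p0.
Hypothesis piP : stationary_policy pi.
Hypothesis PP : transition P.
Local Notation X := (S * A)%type.

Definition policy_kernel (s s' : S) : R := \sum_a pi s a * P (s, a, s').

Definition policy_reward (s : S) : R :=
  \sum_a pi s a * row_mean P s a (fun s' => r (s, a, s')).

Local Notation K := (kmean policy_kernel).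
Local Notation mu := (path_law p0 (of_stationary pi) P).

Lemma policy_kernelP s : simplex (policy_kernel s).
Proof.
split=> [s'|].
  by apply: sumr_ge0 => a _; rewrite mulr_ge0 ?(piP s).1 ?(PP s a).1.
rewrite exchange_big/= -(piP s).2; apply: eq_bigr => a _.
by rewrite -mulr_sumr (PP s a).2 mulr1.
Qed.

Lemma policy_kmean f s : K f s = \sum_a pi s a * row_mean P s a f.
Proof.
rewrite /kmean /policy_kernel; under eq_bigr do rewrite mulr_suml.
rewrite exchange_big/=; apply: eq_bigr => a _; rewrite mulr_sumr.
by apply: eq_bigr => s' _; rewrite mulrA.
Qed.

Lemma of_stationary_policy : history_policy (of_stationary pi).
Proof. by move=> h; exact: piP. Qed.

Lemma stationary_law : trajectory_law (step p0 (of_stationary pi) P) mu.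
Proof. by apply: path_lawP => //; exact: of_stationary_policy. Qed.

(** Averaging over the last pair turns [f] into a function of the pair before it, whose mean under
    [pi] is one application of the kernel. A prefix of length [n + 1] ends at time [n]. *)
Lemma stationary_hmean n (f : X -> R) :
  hmean (step p0 (of_stationary pi) P) n.+1 (fun h => f (last point h)) =
  \sum_s p0 s * iter n K (fun s => \sum_a pi s a * f (s, a)) s.
Proof.
elim: n f => [|n ih] f; first by rewrite /= step_first.
rewrite -[LHS]/(hmean _ n.+1 _).
pose g (x : X) := row_mean P x.1 x.2 (fun s => \sum_a pi s a * f (s, a)).
transitivity (hmean (step p0 (of_stationary pi) P) n.+1 (fun h => g (last point h))).
  apply: eq_hmean => h hn; under eq_bigr do rewrite last_rcons.
  by rewrite step_next ?hn// /g; case: (last point h).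
rewrite ih; apply: eq_bigr => s _; rewrite iterSr; congr (_ * iter n K _ _).
by apply/funext => t; rewrite policy_kmean.
Qed.

Lemma stationary_reward t :
  fine (expectation mu (fun w => reward r w t)) =
  \sum_s p0 s * iter t K policy_reward s.
Proof.
transitivity (fine (expectation mu
    (fun w : traj X => hreward r (mkseq w t.+2) t))).
  by congr (fine (expectation _ _)); apply/funext => w; exact: rewardE.
rewrite (prefix_mean stationary_law t.+2 (fun h => hreward r h t)).
rewrite -[LHS]/(hmean _ t.+1 _).
pose g (x : X) := row_mean P x.1 x.2 (fun s => r (x, s)).
transitivity (hmean (step p0 (of_stationary pi) P) t.+1 (fun h => g (last point h))).
  apply: eq_hmean => h hn.
  under eq_bigr do rewrite /hreward !nth_rcons hn ltnn ltnS leqnn eqxx /=.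
  rewrite (@step_next_state _ _ _ _ _ _ h (fun s => r (nth point h t, s)) of_stationary_policy) ?hn//.
  by rewrite /g -nth_last hn; case: (nth point h t).
by rewrite stationary_hmean.
Qed.

Definition state_mean t (f : S -> R) : R := \sum_s p0 s * iter t K f s.

Lemma state_meanD t f g :
  state_mean t (fun s => f s + g s) = state_mean t f + state_mean t g.
Proof.
rewrite /state_mean -big_split; apply: eq_bigr => s _.
by rewrite iter_kmeanD mulrDr.
Qed.

Lemma state_meanZ t c f : state_mean t (fun s => c * f s) = c * state_mean t f.
Proof.
rewrite /state_mean mulr_sumr; apply: eq_bigr => s _.
by rewrite iter_kmeanZ mulrCA.
Qed.

Lemma state_meanS t f : state_mean t (K f) = state_mean t.+1 f.
Proof. by rewrite /state_mean; under [RHS]eq_bigr do rewrite iterSr. Qed.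

Lemma state_mean_ge0 t f : (forall s, 0 <= f s) -> 0 <= state_mean t f.
Proof.
move=> f0; apply: sumr_ge0 => s _; rewrite mulr_ge0 ?p0P.1//.
rewrite -(iter_kmean_cst policy_kernelP t 0 s).
exact: (ler_iter_kmean policy_kernelP).
Qed.

Lemma state_mean_norm t f b : (forall s, `|f s| <= b) -> `|state_mean t f| <= b.
Proof.
move=> fb; apply: le_trans (ler_norm_sum _ _ _) _.
rewrite -[leRHS]mul1r -p0P.2 mulr_suml; apply: ler_sum => s _.
rewrite normrM ger0_norm ?p0P.1// ler_wpM2l ?p0P.1//.
exact: (iter_kmean_norm policy_kernelP).
Qed.

Local Notation discounted g := (fine (expectation mu
     (fun w => limn (series (fun t => g ^+ t * reward r w t))))).

Let rbounded : exists2 B : R, 0 <= B & forall i, `|r i| <= B := finfun_bounded r.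

(* Both bounds below follow from the exact expansion of the truncated
   discounted sum along the residual [policy_reward + g K V - V]. *)
Let truncated g (V : S -> R) n :
  \sum_(t < n) g ^+ t * state_mean t policy_reward =
  state_mean 0 V - g ^+ n * state_mean n V +
  \sum_(t < n) g ^+ t * state_mean t (fun s => policy_reward s + g * K V s + -1 * V s).
Proof.
elim: n => [|n ih]; first by rewrite !big_ord0 expr0 mul1r subrr addr0.
rewrite !big_ord_recr/= ih !state_meanD !state_meanZ state_meanS exprS.
by ring.
Qed.

(** The added boundary term vanishes in the limit since [V] is bounded; it cancels the one in
    [truncated]. *)
Let truncated_cvg g (V : S -> R) : 0 <= g < 1 ->
  \sum_(t < n) g ^+ t * state_mean t policy_reward + g ^+ n * state_mean n V
    @[n --> \oo] --> discounted g.
Proof.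
move=> g01; have [B _ rB] := rbounded; have [b b0 Vb] := finfun_bounded V.
rewrite -[discounted g]addr0; apply: cvgD.
  have := @discounted_cvg _ _ _ _ _ rB mu _ g01.
  by under eq_fun do under eq_bigr do rewrite stationary_reward.
have /andP[g0 g1] := g01.
have gb : g ^+ n * b @[n --> \oo] --> 0.
  rewrite -(mul0r b); apply: cvgM; last exact: cvg_cst.
  have := @cvg_geometric _ 1 g; rewrite ger0_norm// => /(_ g1).
  by rewrite /geometric/=; under eq_fun do rewrite mul1r.
apply: norm_cvg0; apply: squeeze_cvgr gb; last exact: cvg_cst.
apply: nearW => n; rewrite normr_ge0 normrM ger0_norm ?exprn_ge0//=.
by rewrite ler_wpM2l ?exprn_ge0// state_mean_norm.
Qed.

Lemma discounted_ge g (V : S -> R) : 0 <= g < 1 ->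
  (forall s, V s <= policy_reward s + g * K V s) ->
  \sum_s p0 s * V s <= discounted g.
Proof.
move=> g01 VL; have /andP[g0 _] := g01.
apply: (cvgr_to_ge (truncated_cvg V g01)); apply: nearW => n.
rewrite (truncated g V n) addrAC subrK lerDl sumr_ge0// => t _.
rewrite mulr_ge0 ?exprn_ge0// state_mean_ge0// => s.
by rewrite mulN1r subr_ge0.
Qed.

Lemma discounted_le g (V : S -> R) : 0 <= g < 1 ->
  (forall s, policy_reward s + g * K V s <= V s) ->
  discounted g <= \sum_s p0 s * V s.
Proof.
move=> g01 VL; have /andP[g0 _] := g01.
apply: (cvgr_to_le (truncated_cvg V g01)); apply: nearW => n.
rewrite (truncated g V n) addrAC subrK gerDl -oppr_ge0 -sumrN sumr_ge0// => t _.
rewrite -mulrN -mulN1r -state_meanZ mulr_ge0 ?exprn_ge0// state_mean_ge0// => s.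
by rewrite !mulN1r oppr_ge0 subr_le0.
Qed.

Section gain.
Variables k y : S -> R.
Hypothesis kK : forall s, K k s = k s.
Hypothesis rky : forall s, policy_reward s = k s + y s - K y s.

Local Notation gain := (\sum_s p0 s * k s).

Lemma discounted_gain g b : 0 <= g < 1 -> (forall s, `|y s| <= b) ->
  (1 - g) * discounted g <= gain + (1 - g) * (b + b).
Proof.
move=> /andP[g0 g1] yb; have g1' : 0 < 1 - g by rewrite subr_gt0.
(* [k / (1 - g) + y] solves the discounted equation up to [(1 - g) * K y]; adding the bound [b] of
   [y] makes it a supersolution. *)
pose V s := (1 - g)^-1 * k s + y s + b.
have Ky s : `|K y s| <= b by exact: (iter_kmean_norm policy_kernelP 1).
have : discounted g <= \sum_s p0 s * V s.
  apply: discounted_le => [|s]; first by rewrite g0 g1.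
  have -> : K V s = (1 - g)^-1 * k s + K y s + b.
    rewrite /V !kmeanD kmeanZ kK (kmean_cst policy_kernelP)//.
  rewrite rky /V -subr_ge0.
  have -> : (1 - g)^-1 * k s + y s + b -
     (k s + y s - K y s + g * ((1 - g)^-1 * k s + K y s + b)) = (1 - g) * (b + K y s).
    by field; rewrite gt_eqF.
  rewrite mulr_ge0 ?(ltW g1')//; have := Ky s; rewrite ler_norml => /andP[]; lra.
move=> dV; apply: le_trans (_ : (1 - g) * \sum_s p0 s * V s <= _).
  by rewrite ler_wpM2l// ltW.
have -> : \sum_s p0 s * V s = (1 - g)^-1 * gain + \sum_s p0 s * y s + b.
  rewrite /V; under eq_bigr do rewrite !mulrDr mulrCA.
  by rewrite !big_split/= -mulr_sumr -mulr_suml p0P.2 mul1r.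
rewrite -!addrA mulrDr mulrA mulfV ?gt_eqF// mul1r lerD2l ler_wpM2l ?(ltW g1')//.
rewrite lerD2r; apply: le_trans (ler_norm _) _.
exact: (state_mean_norm 0).
Qed.

(** By [rky] the expected rewards are the gain plus a telescoping term, so the average up to [T] is
    within a bounded quantity over [T + 1] of the gain. *)
Lemma average_cvg :
  fine (expectation mu (fun w => average_reward r w T)) @[T --> \oo] --> gain.
Proof.
have [b b0 yb] := finfun_bounded y.
have kn t : state_mean t k = gain.
  apply: eq_bigr => s _; congr (_ * _).
  by elim: t s => //= t ih s; rewrite -[RHS]kK; congr (K _ _); exact/funext.
have rt t : state_mean t policy_reward =
    gain + state_mean t y - state_mean t.+1 y.
  rewrite -(kn t) -(state_meanS t) -state_meanD -mulN1r -state_meanZ -state_meanD.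
  by congr state_mean; apply/funext => s; rewrite mulN1r rky.
have E T : fine (expectation mu (fun w => average_reward r w T)) =
    gain + T.+1%:R^-1 * (state_mean 0 y - state_mean T.+1 y).
  rewrite /average_reward meanZ; last first.
    rewrite (_ : (fun _ => _) = fun w => \sum_(t < T.+1) reward r w t).
      by apply: bmfun_sum => t; exact: reward_bmfun.
    by apply/funext => w; rewrite big_mkord.
  rewrite (_ : (fun _ => _) = fun w => \sum_(t < T.+1) reward r w t); last first.
    by apply/funext => w; rewrite big_mkord.
  rewrite mean_sum => [|t]; last exact: reward_bmfun.
  under eq_bigr do rewrite stationary_reward -/(state_mean _ _) rt.
  have -> n : \sum_(t < n) (gain + state_mean t y - state_mean t.+1 y) =
      n%:R * gain + (state_mean 0 y - state_mean n y).
    elim: n => [|n ih]; first by rewrite big_ord0 mul0r subrr addr0.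
    by rewrite big_ord_recr/= ih -natr1; ring.
  by rewrite mulrDr mulrA mulVf ?mul1r// pnatr_eq0.
under eq_fun do rewrite E.
suff : T.+1%:R^-1 * (state_mean 0 y - state_mean T.+1 y) @[T --> \oo] --> 0.
  by move=> /(cvgD (cvg_cst gain)); rewrite addr0.
have hb : harmonic T * (b + b) @[T --> \oo] --> 0.
  by rewrite -(mul0r (b + b)); apply: cvgM; [exact: cvg_harmonic|exact: cvg_cst].
apply: norm_cvg0; apply: squeeze_cvgr hb; last exact: cvg_cst.
apply: nearW => T; rewrite normr_ge0 normrM normfV normr_nat/=.
rewrite ler_wpM2l// (le_trans (ler_normB _ _))// lerD// state_mean_norm//.
Qed.

(** A reverse Fatou inequality: each average is at most the supremum of its tail, and both
    expectations converge. *)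
Lemma gain_le_limsup :
  gain <= fine (expectation mu (fun w => limn_sup (average_reward r w))).
Proof.
have [B _ rB] := rbounded.
apply: (@ler_cvg_to _ \oo _ _ _ _ _ _ average_cvg (@average_limsup_cvg _ _ _ _ _ rB mu)).
apply: nearW => T; apply: ler_mean => [||w].
- exact: average_reward_bmfun.
- exact: average_sups_bmfun.
- by have [_ + _] := limn_sup_bounds (average_reward_norm rB w).
Qed.

End gain.
End stationary.

(** * History-dependent policies *)

(** Borel-Cantelli: the unions of tails decrease to the limit superior of the events, which is null
    since the masses are summable. *)
Lemma bigcup_tail_cvg0 (d : measure_display) (T : measurableType d) (R : realType)
    (mu : probability T R) (F : nat -> set T) (C : R) :
  (forall n, measurable (F n)) ->
  (forall n, \sum_(t < n) fine (mu (F t)) <= C) ->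
  fine (mu (\bigcup_(k in [set k | (n <= k)%N]) F k)) @[n --> \oo] --> 0.
Proof.
move=> mF FC.
have fin A : measurable A -> mu A \is a fin_num by move=> mA; exact: fin_num_measure.
have mU n : measurable (\bigcup_(k in [set k | (n <= k)%N]) F k).
  by apply: bigcup_measurable => k _.
have sum : (\sum_(0 <= t <oo) mu (F t) < +oo)%E.
  apply: (@le_lt_trans _ _ C%:E); last exact: ltry.
  apply: lime_le; first by apply: is_cvg_nneseries => n _ _; exact: measure_ge0.
  apply: nearW => n; rewrite big_mkord (eq_bigr (fun t : 'I_n => (fine (mu (F t)))%:E)).
    by rewrite sumEFin lee_fin; exact: FC.
  by move=> t _; rewrite fineK ?fin.
have := @lim_sup_set_cvg _ _ _ mu F mF; rewrite (lim_sup_set_cvg0 mF sum).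
have lt : (mu (\bigcup_(k in [set k | (0 <= k)%N]) F k) < +oo)%E.
  by apply: le_lt_trans (probability_le1 mu (mU 0%N)) _; exact: ltry.
move=> /(_ lt) cv; have := fine_cvg cv; exact.
Qed.

(** Invert [expR (- x) >= 1 - x], then check that the quadratic times [1 - x] is at least 1. It
    serves the exponential moments in [lates]. *)
Lemma expR_le_quadratic (R : realType) (x : R) : `|x| <= 1 / 2 ->
  expR x <= 1 + x + 2 * x ^+ 2.
Proof.
rewrite ler_norml => /andP[x1 x2].
have x0 : 0 < 1 - x by lra.
have : expR x <= (1 - x)^-1.
  rewrite -[expR x]invrK -expRN lef_pV2 ?posrE ?expR_gt0//.
  exact: expR_ge1Dx.
move/le_trans; apply; rewrite -[leLHS]mul1r ler_pdivrMr//.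
have -> : (1 + x + 2 * x ^+ 2) * (1 - x) = 1 + x ^+ 2 * (1 - 2 * x) by ring.
by rewrite lerDl mulr_ge0 ?sqr_ge0//; lra.
Qed.

Section local_functions.
Context {R : realType} {X : pfinType}.

Definition prefix_local n (f : traj X -> R) : Prop :=
  forall w w', (forall i, (i < n)%N -> w i = w' i) -> f w = f w'.

Lemma prefix_localE n (f : traj X -> R) w : prefix_local n f ->
  f w = f (nth point (mkseq w n)).
Proof. by move=> fl; apply: fl => i ni; rewrite nth_mkseq. Qed.

Lemma prefix_local_bmfun n f : prefix_local n f -> bmfun f.
Proof.
move=> fl; rewrite (_ : f = fun w => f (nth point (mkseq w n))).
  exact: (prefix_bmfun n (fun h => f (nth point h))).
by apply/funext => w; exact: prefix_localE.
Qed.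

Lemma prefix_local_measurable n (A : set (traj X)) :
  (forall w w', (forall i, (i < n)%N -> w i = w' i) -> A w -> A w') ->
  measurable A.
Proof.
move=> Al; apply/(@measurable_indicP _ _ R).
suff /prefix_local_bmfun[] : prefix_local n (\1_A : traj X -> R) by [].
move=> w w' ww'; rewrite !indicE; congr (nat_of_bool _)%:R.
apply/idP/idP => /set_mem Aw; apply/mem_set; apply: Al Aw => // i ni.
by rewrite ww'.
Qed.

End local_functions.

Section history_upper_bound.
Context {R : realType} {S A : pfinType}.
Variables (r : S * A * S -> R) (p0 : S -> R) (pi : hpolicy R S A) (P : S * A * S -> R).
Hypothesis p0P : simplex p0.
Hypothesis piP : history_policy pi.
Hypothesis PP : transition P.
Local Notation X := (S * A)%type.
Local Notation mu := (path_law p0 pi P).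
Local Notation E f := (fine (expectation mu f)).

Let muP : trajectory_law (step p0 pi P) mu.
Proof. exact: path_lawP. Qed.

Lemma local_mean n (f : traj X -> R) : prefix_local n f ->
  E f = hmean (step p0 pi P) n (fun h => f (nth point h)).
Proof.
move=> fl; rewrite -(prefix_mean muP); congr (fine (expectation _ _)).
by apply/funext => w; exact: prefix_localE.
Qed.

(** Given the first [t + 1] pairs, which determine [f], the next state follows the row of [P] at the
    last pair, whatever the policy. *)
Lemma mean_step t (f : traj X -> R) (g : X -> S -> R) : prefix_local t.+1 f ->
  E (fun w => f w * g (w t) (w t.+1).1) =
  E (fun w => f w * row_mean P (w t).1 (w t).2 (g (w t))).
Proof.
move=> fl; rewrite (@local_mean t.+2) => [|w w' ww']; last first.
  by rewrite (fl w w') ?ww'// => i it; apply: ww'; exact: leqW.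
rewrite (@local_mean t.+1) => [|w w' ww']; last by rewrite (fl w w') ?ww'.
rewrite -[LHS]/(hmean _ t.+1 _); apply: eq_hmean => h hn.
have lt : nth point h t = last point h by rewrite -nth_last hn.
rewrite lt -(@step_next_state _ _ _ p0 pi P h (g (last point h)) piP) ?hn// mulr_sumr.
apply: eq_bigr => y _; rewrite !nth_rcons hn ltnn ltnS leqnn eqxx/= mulrCA.
rewrite lt; congr (_ * _).
by apply: fl => i it; rewrite nth_rcons hn it.
Qed.

Lemma mean_initial (f : S -> R) : E (fun w => f (w 0%N).1) = \sum_s p0 s * f s.
Proof.
rewrite (@local_mean 1) => [|w w' ww']; last by rewrite ww'.
by rewrite /= step_first_state.
Qed.

Variables (u h : S -> R) (e : R).
Hypothesis e0 : 0 < e.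
Hypothesis uP : forall s a, row_mean P s a u <= u s.
Hypothesis hP : forall s a,
  row_mean P s a (fun s' => r (s, a, s') + h s') - h s <= u s + e.

Let P1 s a c : row_mean P s a (fun=> c) = c.
Proof. by rewrite /row_mean -mulr_suml (PP s a).2 mul1r. Qed.

Let le_row s a f g : (forall s', f s' <= g s') -> row_mean P s a f <= row_mean P s a g.
Proof. by apply: ler_row_mean; exact: (PP s a).1. Qed.

Let mean_u t : E (fun w => u (w t).1) <= \sum_s p0 s * u s.
Proof.
elim: t => [|t]; first by rewrite mean_initial.
apply: le_trans.
have := @mean_step t (fun=> 1) (fun _ => u) (fun _ _ _ => erefl).
have -> : (fun w : nat -> X => 1 * u (w t.+1).1) = (fun w => u (w t.+1).1).
  by apply/funext => w; rewrite mul1r.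
move=> ->; apply: ler_mean => [||w].
- by apply: (@prefix_local_bmfun _ _ t.+1) => w w' ww'; rewrite ww'.
- by apply: (@prefix_local_bmfun _ _ t.+1) => w w' ww'; rewrite ww'.
- by rewrite mul1r.
Qed.

Let jump t : set (traj X) := [set w | u (w t).1 != u (w t.+1).1].

Let mjump t : measurable (jump t).
Proof.
apply: (@prefix_local_measurable R _ t.+2) => w w' ww'.
by rewrite /jump/= !ww'.
Qed.

(* The concave function [2 b x - x^2] of the supermartingale [u (w t)] drops on
   average by the mean square of the jump. *)
Let jumps : exists C : R, forall n, \sum_(t < n) fine (mu (jump t)) <= C.
Proof.
have [b b0 ub] := finfun_bounded u.
(* [u] has finitely many values, so the squares of its jumps are bounded away from 0. *)
have [J J0 JP] : exists2 J : R, 0 <= J &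
    forall s s', (u s != u s')%:R <= J * (u s' - u s) ^+ 2.
  pose f (x : S * S) := ((u x.2 - u x.1) ^+ 2)^-1.
  have [J J0 JP] := finfun_bounded f; exists J => // s s'.
  have [_|uss] := eqVneq (u s) (u s'); first by rewrite mulr_ge0 ?sqr_ge0.
  have sq : 0 < (u s' - u s) ^+ 2.
    by rewrite lt_def sqr_ge0 sqrf_eq0 subr_eq0 eq_sym uss.
  by rewrite -ler_pdivrMr// mul1r; exact: le_trans (ler_norm _) (JP (s, s')).
pose Phi s := (b + b) * u s - u s ^+ 2.
have bf t (f : S -> R) : bmfun (fun w : traj X => f (w t).1).
  by apply: (@prefix_local_bmfun _ _ t.+1) => w w' ww'; rewrite ww'.
have drop t : fine (mu (jump t)) <=
    J * (E (fun w => Phi (w t).1) - E (fun w => Phi (w t.+1).1)).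
  have -> : fine (mu (jump t)) = E \1_(jump t) by rewrite mean_indic.
  have bs : bmfun (fun w : traj X => (u (w t.+1).1 - u (w t).1) ^+ 2).
    by apply: (@prefix_local_bmfun _ _ t.+2) => w w' ww'; rewrite !ww'.
  apply: (@le_trans _ _ (J * E (fun w => (u (w t.+1).1 - u (w t).1) ^+ 2))).
    rewrite -meanZ//; apply: ler_mean; [exact: bmfun_indic|exact: bmfunZ|].
    by move=> w; rewrite indicE /jump/= mem_setE; exact: JP.
  rewrite ler_wpM2l// lerBrDr -meanD//.
  have := @mean_step t (fun=> 1) (fun x s' => (u s' - u x.1) ^+ 2 + Phi s')
    (fun _ _ _ => erefl).
  have -> : (fun w : nat -> X => 1 * ((u (w t.+1).1 - u (w t).1) ^+ 2 + Phi (w t.+1).1)) =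
      (fun w => (u (w t.+1).1 - u (w t).1) ^+ 2 + Phi (w t.+1).1).
    by apply/funext => w; rewrite mul1r.
  move=> ->; apply: ler_mean => [||w]; last 1 first.
  - rewrite mul1r; case: (w t) => s a /=.
    (* The squares of [u s'] cancel: what remains is affine in [u s'], with a slope that is
       nonnegative since [b] bounds [u], so [uP] applies. *)
    rewrite (_ : (fun s' => _) = fun s' => (b + b - 2 * u s) * u s' + u s ^+ 2).
      rewrite row_meanD row_meanZ P1 /Phi.
      have : (b + b - 2 * u s) * row_mean P s a u <= (b + b - 2 * u s) * u s.
        rewrite ler_wpM2l//; have := ub s; rewrite ler_norml => /andP[]; lra.
      by move: (row_mean _ _ _ _) => m; rewrite mulrBl; lra.
    by apply/funext => s'; rewrite /Phi; ring.
  - by apply: (@prefix_local_bmfun _ _ t.+1) => w w' ww'; rewrite !ww'.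
  - exact: bf.
have [c c0 Phic] := finfun_bounded Phi.
exists (J * (c + c)) => n.
apply: (@le_trans _ _ (\sum_(t < n)
    J * (E (fun w => Phi (w t).1) - E (fun w => Phi (w t.+1).1)))).
  by apply: ler_sum => t _; exact: drop.
rewrite -mulr_sumr ler_wpM2l//.
have -> : \sum_(t < n) (E (fun w => Phi (w t).1) - E (fun w => Phi (w t.+1).1)) =
    E (fun w => Phi (w 0%N).1) - E (fun w => Phi (w n).1).
  elim: n => [|n ih]; first by rewrite big_ord0 subrr.
  by rewrite big_ord_recr/= ih; ring.
rewrite -[X in _ <= _ + X]opprK; apply: lerB.
  rewrite -[leRHS](mean_cst mu); apply: ler_mean => [||w]; [exact: bf|exact: bmfun_cst|].
  exact: le_trans (ler_norm _) (Phic _).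
rewrite -[leLHS](mean_cst mu); apply: ler_mean => [||w]; [exact: bmfun_cst|exact: bf|].
by have := Phic (w n).1; rewrite ler_norml => /andP[].
Qed.

(** By [hP] its mean over the next state is nonpositive, so [gap_sum] is a supermartingale with
    bounded increments. *)
Let gap (x : X) s' := r (x, s') + h s' - h x.1 - u x.1 - e.

Let gap_sum n (w : traj X) := \sum_(t < n) gap (w t) (w t.+1).1.

Let gap_sum_local n w w' : (forall i, (i < n.+1)%N -> w i = w' i) ->
  gap_sum n w = gap_sum n w'.
Proof.
move=> ww'; apply: eq_bigr => t _.
by rewrite !ww' ?ltnS// ltnW// ltnS.
Qed.

Let late d n : set (traj X) := [set w | d * n%:R <= gap_sum n w].

Let mlate d n : measurable (late d n).
Proof.
apply: (@prefix_local_measurable R _ n.+1) => w w' ww'.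
by rewrite /late/= (gap_sum_local ww').
Qed.

(** Chernoff bound: the mean of [expR (l * gap_sum n)] is at most [expR c ^+ n], so the mass of
    [late d n] is at most the [n]-th power of [expR (c - l * d) < 1], which is summable. *)
Let lates d : 0 < d -> d <= 1 -> exists C : R, forall n, \sum_(t < n) fine (mu (late d t)) <= C.
Proof.
move=> d0 d1.
have [b1 b10 gb] := finfun_bounded (fun y : X * S => gap y.1 y.2).
pose b := b1 + 1; have b1' : 1 <= b by rewrite /b; lra.
have {}gb x s' : `|gap x s'| <= b by apply: le_trans (gb (x, s')) _; rewrite /b; lra.
have bp : 0 < b by lra.
(* This [l] minimizes [c - l * d], which becomes [- l * d / 2]; as [d <= 1 <= b], it also keeps
   [l * b] in the range of the quadratic bound. *)
pose l := d / (4 * b ^+ 2).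
have b2 : 0 < 4 * b ^+ 2 by rewrite mulr_gt0// exprn_gt0.
have l0 : 0 < l by rewrite divr_gt0.
have lb : l * b <= 1 / 2.
  have -> : l * b = d / (4 * b) by rewrite /l; field; rewrite gt_eqF.
  rewrite ler_pdivrMr; last lra.
  lra.
pose c := 2 * (l * b) ^+ 2.
have mono n : E (fun w => expR (l * gap_sum n w)) <= expR c ^+ n.
  elim: n => [|n ih].
    rewrite expr0 -[leRHS](mean_cst mu); apply: ler_mean => [||w].
    - by apply: (@prefix_local_bmfun _ _ 1) => w w' /gap_sum_local ->.
    - exact: bmfun_cst.
    - by rewrite /gap_sum big_ord0 mulr0 expR0.
  apply: (@le_trans _ _ (expR c * E (fun w => expR (l * gap_sum n w)))); last first.
    by rewrite exprS ler_wpM2l// expR_ge0.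
  have lo m : bmfun (fun w : traj X => expR (l * gap_sum m w)).
    by apply: (@prefix_local_bmfun _ _ m.+1) => w w' /gap_sum_local ->.
  rewrite -meanZ//.
  have -> : (fun w : traj X => expR (l * gap_sum n.+1 w)) =
    fun w : traj X => expR (l * gap_sum n w) * expR (l * gap (w n) (w n.+1).1).
    by apply/funext => w; rewrite /gap_sum big_ord_recr/= mulrDr expRD.
  rewrite (@mean_step n _ (fun x s' => expR (l * gap x s'))); last first.
    by move=> w w' /gap_sum_local ->.
  apply: ler_mean => [||w]; last 1 first.
  - rewrite mulrC ler_wpM2r ?expR_ge0//; case: (w n) => s a /=.
    apply: (@le_trans _ _ (1 + c)); last exact: expR_ge1Dx.
    apply: (@le_trans _ _ (row_mean P s a (fun s' => l * (r (s, a, s') + h s') +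
        (1 + c - l * (h s + u s + e))))).
      apply: le_row => s'.
      have lg : `|l * gap (s, a) s'| <= l * b.
        by rewrite normrM (gtr0_norm l0) ler_pM2l.
      apply: le_trans (expR_le_quadratic (le_trans lg lb)) _.
      have : (l * gap (s, a) s') ^+ 2 <= (l * b) ^+ 2.
        by rewrite -real_normK ?num_real// ler_pXn2r// nnegrE// mulr_ge0// ltW.
      by rewrite /c /gap/=; lra.
    rewrite row_meanD P1 row_meanZ.
    have : l * (row_mean P s a (fun s' => r (s, a, s') + h s') - h s) <= l * (u s + e).
      by rewrite ler_pM2l.
    by move: (row_mean _ _ _ _) => m; rewrite mulrBr; lra.
  - apply: (@prefix_local_bmfun _ _ n.+1) => w w' ww'.
    by rewrite (gap_sum_local ww') ww'.
  - exact: bmfunZ.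
have cd : expR c * expR (- (l * d)) < 1.
  rewrite -expRD expR_lt1 /c.
  have -> : 2 * (l * b) ^+ 2 = l * d / 2 by rewrite /l; field; rewrite gt_eqF.
  by have := mulr_gt0 l0 d0; lra.
pose q := expR c * expR (- (l * d)).
have q0 : 0 <= q by rewrite mulr_ge0 ?expR_ge0.
exists (1 - q)^-1 => n.
apply: (@le_trans _ _ (\sum_(t < n) q ^+ t)); last first.
  have := @geometric_seriesE _ 1 q (negbT (lt_eqF cd)).
  move=> /(congr1 (fun f => f n)); rewrite /series/= big_mkord.
  rewrite (eq_bigr (fun t : 'I_n => q ^+ t)) => [|t _]; last by rewrite /= mul1r.
  move=> ->; rewrite mul1r -[leRHS]mul1r ler_pM2r ?invr_gt0 ?subr_gt0//.
  by rewrite gerBl exprn_ge0.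
apply: ler_sum => t _.
rewrite -(mean_indic mu (mlate d t)) /q exprMn -[expR (- _) ^+ t]expRM_natl mulrN.
rewrite [leRHS]mulrC; apply: le_trans (_ : expR (- (t%:R * (l * d))) *
   E (fun w => expR (l * gap_sum t w)) <= _); last by rewrite ler_pM2l ?expR_gt0.
have lo : bmfun (fun w : traj X => expR (l * gap_sum t w)).
  by apply: (@prefix_local_bmfun _ _ t.+1) => w w' /gap_sum_local ->.
rewrite -meanZ//; apply: ler_mean => [||w]; [exact: bmfun_indic|exact: bmfunZ|].
rewrite indicE; have [/set_mem wl|_] := boolP (w \in late d t); last first.
  by rewrite mulr_ge0 ?expR_ge0.
apply: (@le_trans _ _ (expR 0)); first by rewrite expR0.
rewrite -expRD ler_expR addrC subr_ge0 mulrCA ler_pM2l// mulrC.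
exact: wl.
Qed.

(** By Borel-Cantelli, off a set [U N] of small mass, [u] is constant from time [N] on and
    [gap_sum n] is at most [d * n] for [n >= N]; there the averages are at most [u (w N).1 + e] up
    to small terms. On [U N] the bound on the rewards is enough. The mean of [u (w N).1] is at most
    the initial one. *)
Lemma limsup_le :
  E (fun w => limn_sup (average_reward r w)) <= \sum_s p0 s * u s + e.
Proof.
have [B B0 rB] := finfun_bounded r.
have [bu bu0 ub] := finfun_bounded u.
have [bh bh0 hb] := finfun_bounded h.
apply/ler_addgt0Pr => d3 d30.
wlog d31 : d3 d30 / d3 <= 1.
  move=> H; have [/H|/ltW d31] := leP d3 1; first exact.
  by apply: le_trans (H 1 ltr01 (lexx 1)) _; rewrite lerD2l.
(* One [d] pays for the mass of [U N], one for the growth of [gap_sum], and one for the terms of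
   order [1 / m]. *)
have [d [d0 d1 dE]] : exists d : R, [/\ 0 < d, d <= 1 & d + d + d = d3].
  by exists (d3 / 3); split; lra.
have [C1 jC1] := jumps; have [C2 lC2] := lates d0 d1.
pose F n := jump n `|` late d n.
have mF n : measurable (F n) by exact: measurableU.
pose U n := \bigcup_(k in [set k | (n <= k)%N]) F k.
have mU n : measurable (U n) by apply: bigcup_measurable => k _.
have U0 : fine (mu (U n)) @[n --> \oo] --> 0.
  apply: (@bigcup_tail_cvg0 _ _ _ _ _ (C1 + C2)) => // n.
  apply: le_trans (lerD (jC1 n) (lC2 n)); rewrite -big_split/=; apply: ler_sum => t _.
  have fin D : measurable D -> mu D \is a fin_num by move=> mD; exact: fin_num_measure.
  rewrite -fineD ?fin//; apply: fine_le; rewrite ?fin_numD ?fin//.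
  exact: measureU2.
pose C := B + bu + 1.
have C0 : 0 < C by rewrite /C; lra.
have [N UN] : exists N, C * fine (mu (U N)) <= d.
  have dC : 0 < d / C by rewrite divr_gt0.
  have /cvgrPdist_le/(_ _ dC) := U0.
  case=> N _ /(_ N (leqnn N)); rewrite sub0r normrN => UN; exists N.
  by rewrite mulrC -ler_pdivlMr//; exact: le_trans (ler_norm _) UN.
have bN : bmfun (fun w : traj X => u (w N).1).
  by apply: (@prefix_local_bmfun _ _ N.+1) => w w' ww'; rewrite ww'.
have bU : bmfun (fun w : traj X => C * \1_(U N) w) by apply/bmfunZ/bmfun_indic.
have bD : bmfun (fun w : traj X => u (w N).1 + C * \1_(U N) w) by exact: bmfunD.
apply: (@le_trans _ _ (E (fun w => (u (w N).1 + C * \1_(U N) w) + (e + d + d)))); last first.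
  rewrite (meanD mu bD (bmfun_cst _)) (meanD mu bN bU) mean_cst.
  rewrite (meanZ mu C (bmfun_indic (mU N))) (mean_indic mu (mU N)).
  by have := mean_u N; lra.
apply: ler_mean; [exact: average_limsup_bmfun rB|by apply: bmfunD => //; exact: bmfun_cst|].
have e_gt0 := e0.
move=> w; have [sc _ sl] := limn_sup_bounds (average_reward_norm rB w).
have uN : 0 <= u (w N).1 + bu.
  by have := ub (w N).1; rewrite ler_norml -lerBlDr sub0r => /andP[].
have [wU|wU] := boolP (w \in U N).
  have := set_mem wU; rewrite indicE wU mulr1 => _.
  apply: (@le_trans _ _ B); last first.
    by rewrite /C; lra.
  apply: (cvgr_to_le sc); apply: nearW => n; apply: sl => m _.
  exact: le_trans (ler_norm _) (average_reward_norm rB w m).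
rewrite indicE (negPf wU) mulr0 addr0.
have notF k : (N <= k)%N -> ~ F k w.
  by move=> Nk Fk; move/negP: wU; apply; apply/mem_set; exists k.
have ukN k : (N <= k)%N -> u (w k).1 = u (w N).1.
  elim: k => [|k ih]; first by rewrite leqn0 => /eqP ->.
  rewrite leq_eqVlt => /orP[/eqP -> //|]; rewrite ltnS => Nk; rewrite -ih//.
  apply/eqP; rewrite eq_sym; apply/negPn/negP => jk.
  by apply: (notF k Nk); left.
have gapk k : (N <= k)%N -> gap_sum k w <= d * k%:R.
  by move=> Nk; rewrite leNgt; apply/negP => /ltW lk; apply: (notF k Nk); right.
(* [K] bounds the error of the first [N] steps, where [u] may differ from its final value, and the
   end terms of the telescoping sum of [h]. *)
pose K := N%:R * (bu + bu) + (bh + bh).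
have K0 : 0 <= K by rewrite addr_ge0 ?mulr_ge0 ?addr_ge0.
have sumu m : \sum_(t < m) u (w t).1 <= N%:R * (bu + bu) + m%:R * u (w N).1.
  have uu k : u (w k).1 <= u (w N).1 + (k < N)%N%:R * (bu + bu).
    case: ltnP => kN; last by rewrite ukN// mul0r addr0.
    have := ub (w k).1; rewrite mul1r ler_norml => /andP[_].
    by move: uN; lra.
  apply: (@le_trans _ _ (\sum_(t < m) (u (w N).1 + (t < N)%N%:R * (bu + bu)))).
    by apply: ler_sum => t _; exact: uu.
  rewrite big_split/= sumr_const card_ord -mulr_suml addrC -[_ *+ m]mulr_natl lerD2r.
  rewrite ler_wpM2r ?addr_ge0//.
  elim: m => [|m ih]; first by rewrite big_ord0.
  have [mN|Nm] := leqP m.+1 N.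
    apply: le_trans (_ : m.+1%:R <= _); last by rewrite ler_nat.
    rewrite -[m.+1 in leRHS]card_ord -sum1_card natr_sum.
    by apply: ler_sum => i _; case: ltnP.
  by rewrite big_ord_recr/= ltnNge -ltnS Nm addr0.
have tele m : \sum_(t < m) (h (w t.+1).1 - h (w t).1) = h (w m).1 - h (w 0%N).1.
  elim: m => [|m ih]; first by rewrite big_ord0 subrr.
  by rewrite big_ord_recr/= ih; ring.
have avg m : (N <= m)%N -> average_reward r w m <= u (w N).1 + e + d + m.+1%:R^-1 * K.
  move=> Nm; have m0 : 0 < m.+1%:R :> R by rewrite ltr0n.
  rewrite /average_reward ler_pdivrMl// mulrDr mulrA mulfV ?gt_eqF// mul1r big_mkord.
  have := gapk m.+1 (leqW Nm); have := sumu m.+1; have := tele m.+1.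
  have := hb (w m.+1).1; have := hb (w 0%N).1; rewrite !ler_norml.
  move=> /andP[? ?] /andP[? ?].
  have -> : gap_sum m.+1 w = \sum_(t < m.+1) reward r w t +
      \sum_(t < m.+1) (h (w t.+1).1 - h (w t).1) - \sum_(t < m.+1) u (w t).1 - m.+1%:R * e.
    have -> : m.+1%:R * e = \sum_(t < m.+1) e by rewrite sumr_const card_ord mulr_natl.
    rewrite -big_split/= -!sumrB; apply: eq_bigr => t _.
    by rewrite /gap /reward; case: (w t) => s a /=; ring.
  move=> ->; rewrite /K; lra.
have [M MP] : exists M, forall m, (M <= m)%N -> m.+1%:R^-1 * K <= d.
  exists (Num.truncn (K / d)).+1 => m Mm.
  rewrite ler_pdivrMl ?ltr0n// -ler_pdivrMr//.
  apply: le_trans (ltW (truncnS_gt _)) _; rewrite ler_nat.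
  exact: leq_trans Mm _.
apply: (cvgr_to_le sc); exists (maxn N M) => // n; rewrite /= geq_max => /andP[Nn Mn].
apply: sl => m nm; apply: le_trans (avg m (leq_trans Nn nm)) _.
by have := MP m (leq_trans Mn nm); move: (_ * K) => z; lra.
Qed.

End history_upper_bound.

(** * Robust Bellman equations *)

(** Knaster-Tarski: the pointwise supremum of the subsolutions below [M] is a subsolution, and so is
    its image, so the two agree. The constant [- M] is a subsolution, hence the lower bound. *)
Lemma monotone_fixpoint (R : realType) (S : Type) (T : (S -> R) -> S -> R) (M : R) :
  (forall V W, (forall s, V s <= W s) -> forall s, T V s <= T W s) ->
  (forall s, - M <= T (fun=> - M) s) -> (forall s, T (fun=> M) s <= M) ->
  0 <= M -> exists V, (forall s, `|V s| <= M) /\ forall s, T V s = V s.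
Proof.
move=> mono TM TM' M0.
pose sub (W : S -> R) := (forall s, W s <= T W s) /\ forall s, W s <= M.
pose V s : R := sup [set W s | W in sub].
have subM : sub (fun=> - M).
  by split=> // s; apply: (@le_trans _ _ 0); rewrite ?oppr_le0.
have ub s : has_ubound [set W s | W in sub] by exists M => _ [W [_ WM] <-].
have le W s : sub W -> W s <= V s by move=> sW; apply: ub_le_sup => //; exists W.
have VM s : V s <= M.
  by apply: ge_sup; [exists (- M), (fun=> - M)|move=> _ [W [_ WM] <-]].
have VTV s : V s <= T V s.
  apply: ge_sup; first by exists (- M), (fun=> - M).
  move=> _ [W sW <-]; have [WT _] := sW; apply: le_trans (WT s) _.
  by apply: mono => t; exact: le.
have TVV s : T V s <= V s.
  apply: (le (T V)); split; first exact: mono.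
  by move=> t; apply: le_trans (TM' t); exact: mono.
exists V; split=> s; last by apply/eqP; rewrite eq_le TVV VTV.
by rewrite ler_norml VM andbT; exact: le subM.
Qed.

(** The form in which rectangularity is used: near-worst rows chosen pair by pair, or rows of two
    transitions, are glued inside [U]. *)
Lemma sa_rectangular_choice (R : realType) (S A : pfinType)
    (U : set (S * A * S -> R)) (f : S -> A -> S * A * S -> R) :
  sa_rectangular U -> (forall s a, U (f s a)) -> U (fun i => f i.1.1 i.1.2 i).
Proof. by move=> [V [_ ->]] Uf s a; exact: Uf. Qed.

Section robust_values.
Context {R : realType} {S A : pfinType}.
Variables (r : S * A * S -> R) (U : set (S * A * S -> R)) (g : R).
Hypothesis U0 : U !=set0.
Hypothesis UP : U `<=` transition (S := S) (A := A).
Hypothesis Urect : sa_rectangular U.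
Hypothesis g01 : 0 < g < 1.

Let g0 : 0 < g. Proof. by case/andP: g01. Qed.
Let g1 : 0 < 1 - g. Proof. by case/andP: g01 => _; rewrite subr_gt0. Qed.

(** The infimum runs over all of [U], though only the row at (s, a) matters, so that no component
    sets have to be named. *)
Definition worst_case (V : S -> R) s a : R :=
  inf [set row_mean P s a (fun s' => r (s, a, s') + g * V s') | P in U].

Variable B : R.
Hypothesis B0 : 0 <= B.
Hypothesis rB : forall i, `|r i| <= B.

Let row1 P s a c : U P -> row_mean P s a (fun=> c) = c.
Proof. by move=> /UP PP; rewrite /row_mean -mulr_suml (PP s a).2 mul1r. Qed.

Let le_row P s a V W : U P -> (forall s', V s' <= W s') ->
  row_mean P s a V <= row_mean P s a W.
Proof. by move=> /UP PP; apply: ler_row_mean; exact: (PP s a).1. Qed.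

Let has_lb V s a :
  has_lbound [set row_mean P s a (fun s' => r (s, a, s') + g * V s') | P in U].
Proof.
have [b b0 Vb] := finfun_bounded V.
exists (- (B + g * b)) => _ [P UP' <-]; rewrite -(row1 s a (- (B + g * b)) UP').
apply: le_row => // s'; rewrite opprD lerD//.
  by have := rB (s, a, s'); rewrite ler_norml => /andP[].
rewrite -mulrN ler_pM2l//.
by have := Vb s'; rewrite ler_norml => /andP[].
Qed.

Lemma worst_case_le V P s a : U P ->
  worst_case V s a <= row_mean P s a (fun s' => r (s, a, s') + g * V s').
Proof. by move=> UP'; apply: ge_inf => //; exists P. Qed.

(** Near-minimizers chosen at each pair are glued by rectangularity, so one [P] serves all pairs. *)
Lemma worst_case_near V e : 0 < e -> exists2 P, U P & forall s a,
  row_mean P s a (fun s' => r (s, a, s') + g * V s') <= worst_case V s a + e.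
Proof.
move=> e0.
have near (sa : S * A) : exists P, U P /\
    row_mean P sa.1 sa.2 (fun s' => r (sa, s') + g * V s') <= worst_case V sa.1 sa.2 + e.
  case: sa => s a /=.
  have hi : has_inf [set row_mean P s a (fun s' => r (s, a, s') + g * V s') | P in U].
    by split=> //; case: U0 => P UP'; exists (row_mean P s a (fun s' => r (s, a, s') + g * V s')), P.
  have [_ [P UP' <-] /ltW Pe] := inf_adherent e0 hi.
  by exists P.
have [f fP] := choice near.
exists (fun i => f (i.1.1, i.1.2) i).
  apply: (@sa_rectangular_choice _ _ _ U (fun s a => f (s, a))) => // s a.
  by have [] := fP (s, a).
by move=> s a; have [_] := fP (s, a).
Qed.

Lemma ler_worst_case V W s a : (forall s', V s' <= W s') ->
  worst_case V s a <= worst_case W s a.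
Proof.
move=> VW; apply: lb_le_inf.
  by case: U0 => P UP'; exists (row_mean P s a (fun s' => r (s, a, s') + g * W s')), P.
move=> _ [P UP' <-]; apply: le_trans (worst_case_le V s a UP') _.
by apply: le_row => // s'; rewrite lerD2l ler_pM2l.
Qed.

Let M := B / (1 - g).

Let M0 : 0 <= M. Proof. by rewrite divr_ge0// ltW. Qed.

Let BM : B + g * M = M.
Proof. by rewrite /M; field; rewrite gt_eqF. Qed.

Let worst_case_lower s a : - M <= worst_case (fun=> - M) s a.
Proof.
apply: lb_le_inf.
  by case: U0 => P UP'; exists (row_mean P s a (fun s' => r (s, a, s') + g * - M)), P.
move=> _ [P UP' <-]; rewrite -[leLHS](row1 s a _ UP'); apply: le_row => // s'.
rewrite [leLHS](_ : _ = - B + g * - M) ?lerD2r; last by rewrite mulrN -opprD BM.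
by have := rB (s, a, s'); rewrite ler_norml => /andP[].
Qed.

Let worst_case_upper s a : worst_case (fun=> M) s a <= M.
Proof.
case: U0 => P UP'; apply: le_trans (worst_case_le _ s a UP') _.
rewrite -[leRHS](row1 s a _ UP'); apply: le_row => // s'.
rewrite -[leRHS]BM lerD2r; exact: le_trans (ler_norm _) (rB _).
Qed.

Lemma dirac_distP (T : pfinType) (s : T) : simplex (dirac_dist R s).
Proof.
split=> [x|]; first by rewrite /dirac_dist ler0n.
by have := sum_delta s (fun=> 1 : R); under eq_bigr do rewrite mulr1.
Qed.

Section policy.
Variable pi : spolicy R S A.
Hypothesis piP : stationary_policy pi.

Let policy_step P V s : policy_reward r pi P s + g * kmean (policy_kernel pi P) V s =
  \sum_a pi s a * row_mean P s a (fun s' => r (s, a, s') + g * V s').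
Proof.
rewrite policy_kmean /policy_reward mulr_sumr -big_split/=; apply: eq_bigr => a _.
by rewrite row_meanD row_meanZ mulrDr mulrCA.
Qed.

Lemma value_ge V P : U P ->
  (forall s, V s <= \sum_a pi s a * worst_case V s a) ->
  forall s, V s <= value r g pi P s.
Proof.
move=> UP' VL s; rewrite /value /expect -(sum_delta s V).
apply: discounted_ge => //; first exact: dirac_distP; first exact: UP.
  by case/andP: g01 => /ltW -> ->.
move=> t; apply: le_trans (VL t) _; rewrite policy_step; apply: ler_sum => a _.
by rewrite ler_wpM2l ?(piP t).1//; exact: worst_case_le.
Qed.

Lemma robust_value_le V : (forall s, \sum_a pi s a * worst_case V s a <= V s) ->
  forall s, robust_value r U g pi s <= V s.
Proof.
move=> VL s; apply/ler_addgt0Pr => e e0.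
(* An excess of [(1 - g) * e] at every step amounts to [e] after discounting. *)
have [P UP' Pnear] := worst_case_near V (mulr_gt0 g1 e0).
have lb : has_lbound [set value r g pi P' s | P' in U].
  exists (- M) => _ [P' UP'' <-].
  apply: (@value_ge (fun=> - M) P' UP'') => t.
  rewrite -[leLHS]mul1r -(piP t).2 mulr_suml; apply: ler_sum => a _.
  by rewrite ler_wpM2l ?(piP t).1.
apply: (@le_trans _ _ (value r g pi P s)); first by apply: ge_inf => //; exists P.
rewrite /value /expect -[leRHS](sum_delta s (fun s => V s + e)).
apply: discounted_le => //; first exact: dirac_distP; first exact: UP.
  by case/andP: g01 => /ltW -> ->.
move=> t; rewrite policy_step.
apply: (@le_trans _ _ (\sum_a pi t a * (worst_case V t a + e))).
  apply: ler_sum => a _; rewrite ler_wpM2l ?(piP t).1//.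
  have -> : (fun s' => r (t, a, s') + g * (V s' + e)) =
      (fun s' => (r (t, a, s') + g * V s') + g * e).
    by apply/funext => s'; rewrite mulrDr addrA.
  rewrite row_meanD (row1 t a _ UP'); have := Pnear t a.
  by rewrite mulrBl mul1r; move: (row_mean _ _ _ _) (worst_case _ _ _) => ? ?; lra.
under eq_bigr do rewrite mulrDr.
by rewrite big_split/= -mulr_suml (piP t).2 mul1r lerD2r.
Qed.

Lemma robust_value_ge V : (forall s, V s <= \sum_a pi s a * worst_case V s a) ->
  forall s, V s <= robust_value r U g pi s.
Proof.
move=> VL s; apply: lb_le_inf.
  by case: U0 => P UP'; exists (value r g pi P s), P.
by move=> _ [P UP' <-]; exact: value_ge.
Qed.

Lemma robust_value_fix V : (forall s, \sum_a pi s a * worst_case V s a = V s) ->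
  forall s, robust_value r U g pi s = V s.
Proof.
move=> VL s; apply/eqP; rewrite eq_le; apply/andP; split.
  by apply: robust_value_le => t; rewrite VL.
by apply: robust_value_ge => t; rewrite VL.
Qed.

(** The operator of the policy is monotone and preserves the bounds, so it has a fixpoint, which the
    two comparison bounds identify with the robust value. *)
Lemma robust_value_bellman s :
  \sum_a pi s a * worst_case (robust_value r U g pi) s a = robust_value r U g pi s.
Proof.
have [||||V [_ VL]] := @monotone_fixpoint R S
    (fun V s => \sum_a pi s a * worst_case V s a) M.
- move=> V W VW t; apply: ler_sum => a _; rewrite ler_wpM2l ?(piP t).1//.
  exact: ler_worst_case.
- move=> t; rewrite -[leLHS]mul1r -(piP t).2 mulr_suml; apply: ler_sum => a _.
  by rewrite ler_wpM2l ?(piP t).1.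
- move=> t; rewrite -[leRHS]mul1r -(piP t).2 mulr_suml; apply: ler_sum => a _.
  by rewrite ler_wpM2l ?(piP t).1.
- exact: M0.
by have -> : robust_value r U g pi = V by apply/funext => t; exact: robust_value_fix.
Qed.

End policy.

Lemma of_deterministicP (d : S -> A) : stationary_policy (of_deterministic R d).
Proof. by move=> s; exact: dirac_distP. Qed.

(** A fixpoint [W] of the operator that plays a best action dominates the robust value of each
    deterministic policy and is that of the greedy one. So it is the maximum, and both claims are
    read off it. *)
Lemma optimal_bellman (V := optimal_robust_value r U g) :
  (forall s, `|V s| <= B / (1 - g)) /\ forall s a, worst_case V s a <= V s.
Proof.
pose best W s : A := [arg max_(a > point) worst_case W s a]%O.
have bestP W s a : worst_case W s a <= worst_case W s (best W s).
  by rewrite /best; case: arg_maxP => // a' _ /(_ a); exact.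
have [||||W [WM WL]] := @monotone_fixpoint R S (fun V s => worst_case V s (best V s)) M.
- move=> V1 V2 V12 t; apply: le_trans (bestP V2 t (best V1 t)).
  exact: ler_worst_case.
- by move=> t; exact: worst_case_lower.
- by move=> t; exact: worst_case_upper.
- exact: M0.
have detE d s : \sum_a of_deterministic R d s a * worst_case W s a = worst_case W s (d s).
  exact: sum_delta.
suff VW : V = W by rewrite VW; split=> // s a; rewrite -[leRHS]WL; exact: bestP.
have le d s : robust_value r U g (of_deterministic R d) s <= W s.
  apply: robust_value_le; first exact: of_deterministicP.
  by move=> t; rewrite detE -[leRHS]WL; exact: bestP.
have eq s : robust_value r U g (of_deterministic R (best W)) s = W s.
  apply: robust_value_fix; first exact: of_deterministicP.
  by move=> t; rewrite detE WL.
apply/funext => s; apply/eqP; rewrite eq_le; apply/andP; split.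
  apply: ge_sup; first by exists (robust_value r U g (of_deterministic R point) s), point.
  by move=> _ [d _ <-]; exact: le.
apply: ub_le_sup; first by exists (W s) => _ [d _ <-]; exact: le.
by exists (best W).
Qed.

(* An optimal policy only plays actions whose worst case attains the optimal
   value, so that any policy with a smaller support is optimal too. *)
Lemma optimal_support pi pi' P s : stationary_policy pi -> stationary_policy pi' ->
  (forall t, robust_value r U g pi t = optimal_robust_value r U g t) ->
  (forall t a, pi t a = 0 -> pi' t a = 0) -> U P ->
  optimal_robust_value r U g s <= value r g pi' P s.
Proof.
move=> piP pi'P opt sub UP'; have [_ WV] := optimal_bellman.
set V := optimal_robust_value r U g in opt WV *.
have {}opt : robust_value r U g pi = V by apply/funext.
apply: value_ge => // t.
rewrite -[leLHS]mul1r -(pi'P t).2 mulr_suml; apply: ler_sum => a _.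
have [/sub -> |pia] := eqVneq (pi t a) 0; first by rewrite !mul0r.
suff -> : worst_case V t a = V t by [].
have /psumr_eq0P : forall b, true -> 0 <= pi t b * (V t - worst_case V t b).
  by move=> b _; rewrite mulr_ge0 ?(piP t).1 ?subr_ge0.
have sum0 : \sum_b pi t b * (V t - worst_case V t b) = 0.
  under eq_bigr do rewrite mulrBr.
  rewrite sumrB -mulr_suml (piP t).2 mul1r -{2}opt (robust_value_bellman piP) opt.
  by rewrite subrr.
move=> /(_ sum0 a isT) /eqP; rewrite mulf_eq0 (negPf pia)/= subr_eq0 => /eqP ->.
by [].
Qed.

End robust_values.

(** * Vanishing discount *)

Section gains.
Context {R : realType} {S A : pfinType}.
Variables (r : S * A * S -> R) (U : set (S * A * S -> R)).
Hypothesis U0 : U !=set0.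
Hypothesis UP : U `<=` transition (S := S) (A := A).

(** [k] is the invariant part of the policy rewards in [mean_ergodic], that is, the gain of [pi]
    against [P]. *)
Lemma stationary_gain (pi : spolicy R S A) P : stationary_policy pi -> U P ->
  exists k : S -> R,
  [/\ forall (B : R) s, (forall i, `|r i| <= B) -> - B <= k s,
      forall p0, simplex p0 -> \sum_s p0 s * k s <= R_avg r p0 (of_stationary pi) P,
      forall s, limn (fun T => expect (dirac_dist R s) (of_stationary pi) P
                    (fun w => average_reward r w T)) = k s &
      exists c : R, forall (g : R) s, 0 <= g < 1 ->
        (1 - g) * value r g pi P s <= k s + (1 - g) * c].
Proof.
move=> piP /UP PP; have KP := policy_kernelP piP PP.
have [k [y [kK rky]]] := mean_ergodic KP (policy_reward r pi P).
have [b b0 yb] := finfun_bounded y.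
exists k; split=> [B s rB|p0 p0P|s|].
- have := average_cvg (dirac_distP s) piP PP kK rky; rewrite sum_delta => av.
  apply: (cvgr_to_ge av); apply: nearW => T.
  rewrite -[leLHS](mean_cst (path_law (dirac_dist R s) (of_stationary pi) P)).
  apply: ler_mean => [||w]; [exact: bmfun_cst|exact: average_reward_bmfun|].
  by have := average_reward_norm rB w T; rewrite ler_norml => /andP[].
- exact: (gain_le_limsup p0P piP PP kK rky).
- apply/cvg_lim => //; have := average_cvg (dirac_distP s) piP PP kK rky.
  by rewrite sum_delta.
- exists (b + b) => g s g01.
  have := discounted_gain (dirac_distP s) piP PP kK rky g01 yb.
  by rewrite sum_delta.
Qed.

Lemma R_avg_norm B p0 (pi : hpolicy R S A) P : (forall i, `|r i| <= B) ->
  `|R_avg r p0 pi P| <= B.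
Proof.
move=> rB; pose mu := path_law p0 pi P.
have bl := average_limsup_bmfun rB.
have lB w : `|limn_sup (average_reward r w)| <= B.
  have [/cvg_norm/cvgr_to_le + _ _] := limn_sup_bounds (average_reward_norm rB w); apply.
  by apply: nearW => n; apply: sups_norm => m; exact: average_reward_norm.
rewrite ler_norml; apply/andP; split.
  rewrite -(mean_cst mu (- B)); apply: ler_mean => // [|w]; first exact: bmfun_cst.
  by have := lB w; rewrite ler_norml => /andP[].
rewrite -[leRHS](mean_cst mu B); apply: ler_mean => // [|w]; first exact: bmfun_cst.
exact: le_trans (ler_norm _) (lB w).
Qed.

Definition upper_value (w : S -> R) : Prop := forall e : R, 0 < e ->
  exists2 P, U P & forall p0 pi, simplex p0 -> history_policy pi ->
    R_avg r p0 pi P <= \sum_s p0 s * w s + e.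

(* A [k] that satisfies the bound for some [c] dominates the limit of the
   normalized values as [g] tends to 1, that is, the gain of [pi] against [P]. *)
Definition secures (w : S -> R) (pi : spolicy R S A) : Prop :=
  stationary_policy pi /\ forall P (k : S -> R), U P ->
  (exists c : R, forall (g : R) s, 0 <= g < 1 ->
    (1 - g) * value r g pi P s <= k s + (1 - g) * c) -> forall s, w s <= k s.

Lemma secures_R_avg w pi p0 P : secures w pi -> simplex p0 -> U P ->
  \sum_s p0 s * w s <= R_avg r p0 (of_stationary pi) P.
Proof.
move=> [piP wk] p0P PU; have [k [_ kR _ kc]] := stationary_gain piP PU.
apply: le_trans (kR p0 p0P); apply: ler_sum => s _.
by rewrite ler_wpM2l ?p0P.1//; exact: wk kc s.
Qed.

Lemma upper_value_le w p0 pi : upper_value w -> simplex p0 -> history_policy pi ->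
  robust_avg r U p0 pi <= \sum_s p0 s * w s.
Proof.
move=> wU p0P piP; apply/ler_addgt0Pr => e /wU[P PU le].
apply: le_trans (le p0 pi p0P piP); apply: ge_inf; last by exists P.
have [B _ rB] := finfun_bounded r; exists (- B) => _ [Q _ <-].
by have := R_avg_norm p0 pi Q rB; rewrite ler_norml => /andP[].
Qed.

(** A saddle point argument: [upper_value] bounds the robust average of every policy by the mean of
    [w] under [p0], and [pi] guarantees that much against each [P]. *)
Lemma secures_average_optimal w pi p0 : upper_value w -> secures w pi -> simplex p0 ->
  average_optimal r U p0 (of_stationary pi).
Proof.
move=> wU wpi p0P; have piP : history_policy (of_stationary pi) by move=> h; exact: wpi.1.
split=> //; apply/eqP; rewrite eq_le; apply/andP; split.
  apply: ub_le_sup; last by exists (of_stationary pi).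
  by exists (\sum_s p0 s * w s) => _ [pi' pi'P <-]; exact: upper_value_le.
apply: ge_sup; first by exists (robust_avg r U p0 (of_stationary pi)), (of_stationary pi).
move=> _ [pi' pi'P <-]; apply: le_trans (upper_value_le wU p0P pi'P) _.
apply: lb_le_inf.
  by case: U0 => P PU; exists (R_avg r p0 (of_stationary pi) P), P.
by move=> _ [P PU <-]; exact: secures_R_avg.
Qed.

(** A gain is at most the expected limit superior of the averages, so [upper_value] bounds gains
    too; the policy of [d] reaches the bound. *)
Lemma secures_optimal_gain w d : upper_value w -> secures w (of_deterministic R d) ->
  forall s, optimal_gain r U s = w s.
Proof.
move=> wU wd s.
have le d' : inf [set limn (fun T =>
      expect (dirac_dist R s) (of_stationary (of_deterministic R d')) P
        (fun x => average_reward r x T)) | P in U] <= w s.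
  have dP := @of_deterministicP R S A d'.
  apply/ler_addgt0Pr => e /wU[P PU le].
  have [k [_ kR klim _]] := stationary_gain dP PU.
  apply: (@le_trans _ _ (k s)).
    apply: ge_inf; last by exists P.
    have [B _ rB] := finfun_bounded r; exists (- B) => _ [Q QU <-].
    have [k' [k'B _ -> _]] := stationary_gain dP QU.
    exact: k'B.
  have sP := @dirac_distP R S s.
  have := le_trans (kR _ sP) (le _ (of_stationary (of_deterministic R d')) sP (fun=> dP)).
  by rewrite !sum_delta.
apply/eqP; rewrite eq_le; apply/andP; split.
  apply: ge_sup; first by eexists; exists d.
  by move=> _ [d' _ <-]; exact: le.
apply: (@le_trans _ _ (inf [set limn (fun T =>
      expect (dirac_dist R s) (of_stationary (of_deterministic R d)) P
        (fun x => average_reward r x T)) | P in U])).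
  apply: lb_le_inf; first by case: U0 => P PU; eexists; exists P.
  move=> _ [P PU <-]; have [k [_ _ -> kc]] := stationary_gain wd.1 PU.
  exact: wd.2 PU kc s.
apply: ub_le_sup; last by exists d.
by exists (w s) => _ [d' _ <-]; exact: le.
Qed.

End gains.

Section vanishing_discount.
Context {R : realType} {S A : pfinType}.
Variables (r : S * A * S -> R) (U : set (S * A * S -> R)).
Hypothesis U0 : U !=set0.
Hypothesis UP : U `<=` transition (S := S) (A := A).
Hypothesis Urect : sa_rectangular U.
Variables (F : set_system nat) (g : nat -> R) (w : S -> R).
Context {FU : UltraFilter F}.
Hypothesis g01 : forall n, 0 < g n < 1.
Hypothesis gF : g n @[n --> F] --> (1 : R).
Local Notation V n := (optimal_robust_value r U (g n)).
Hypothesis VF : forall s, (1 - g n) * V n s @[n --> F] --> w s.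

Let k0 n : 0 < 1 - g n. Proof. by case/andP: (g01 n) => _; rewrite subr_gt0. Qed.

Let kF : (1 - g n) @[n --> F] --> (0 : R).
Proof. by rewrite -(subrr 1); apply: cvgB gF; exact: cvg_cst. Qed.

(** The near-worst inequality with slack [1 - g n], multiplied by [1 - g n], is hypothesis [xP] of
    [certificate] with [k] and [e] both equal to [1 - g n]. The transition obtained by gluing is the
    one fed to [limsup_le]. *)
Lemma limit_upper_value : compact (U : set {ptws (S * A * S)%type -> R}) ->
  upper_value r U w.
Proof.
move=> Uc e e0; have [B B0 rB] := finfun_bounded r.
have near n : exists P, U P /\ forall s a,
    row_mean P s a (fun s' => r (s, a, s') + g n * V n s') <= V n s + (1 - g n).
  have [P PU Pn] := worst_case_near U0 UP Urect (g01 n) rB (V n) (k0 n).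
  exists P; split=> // s a; apply: le_trans (Pn s a) _; rewrite lerD2r.
  by have [_] := optimal_bellman U0 UP Urect (g01 n) B0 rB; apply.
have [P PP] := choice near.
have [Q [QU PQ]] : exists Q, U Q /\ forall i, P n i @[n --> F] --> Q i.
  move: Uc; rewrite compact_ultra => /(_ (P @ F) (@ultra_fmap _ F _ _ P)) [].
    by apply: nearW => n; have [] := PP n.
  move=> Q [QU PQ]; exists Q; split=> // i.
  exact: (cvg_comp P (fun f : {ptws (S * A * S)%type -> R} => f i) PQ (@proj_continuous _ _ i Q)).
have [d e3 dE] : exists2 d : R, 0 < d & d + d + d = e by exists (e / 3); lra.
have [||n [b [u [h]]]] := certificate (r := r) (x := fun n s => (1 - g n) * V n s)
    _ kF kF PQ VF _ e3.
- by apply: nearW => n; exact: k0.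
- apply: nearW => n s a; have [_ /(_ s a)] := PP n; rewrite row_meanD !row_meanZ.
  move=> /(ler_wpM2l (ltW (k0 n))); rewrite !mulrDr.
  by move: (row_mean _ _ _ _) (row_mean _ _ _ _) => x y; nra.
set P' := fun i => _ => -[uw uP hP].
have P'U : U P'.
  have -> : P' = fun i => (if b i.1.1 i.1.2 then P n else Q) i.
    by apply/funext => i; rewrite /P'; case: ifP.
  apply: (@sa_rectangular_choice _ _ _ U (fun s a => if b s a then P n else Q)) => // s a.
  by case: ifP => // _; have [] := PP n.
exists P' => // p0 pi p0P piP.
apply: le_trans (limsup_le p0P piP (UP P'U) e3 uP hP) _.
have le : \sum_s p0 s * u s <= \sum_s p0 s * w s + d.
  rewrite -[d]mul1r -p0P.2 mulr_suml -big_split/=; apply: ler_sum => s _.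
  rewrite -mulrDr ler_wpM2l ?p0P.1//.
  by have := le_trans (ler_norm _) (uw s); rewrite lerBlDl.
by lra.
Qed.

(** [Z] is the set of unplayed pairs, the same for [F]-almost all [n]. Hence the single policy [pi']
    is optimal for [g n] at all these [n], and the bound by [k] passes to the limit. *)
Lemma limit_secures (pi : nat -> spolicy R S A) (pi' : spolicy R S A) (Z : {set S * A}) :
  (\forall n \near F, [/\ stationary_policy (pi n),
     forall s, robust_value r U (g n) (pi n) s = V n s &
     Z = [set x | pi n x.1 x.2 == 0]%SET]) ->
  stationary_policy pi' -> (forall s a, (s, a) \in Z -> pi' s a = 0) ->
  secures r U w pi'.
Proof.
move=> piZ pi'P pi'Z; split=> // P k PU [c kc] s.
have [B B0 rB] := finfun_bounded r.
have kl : k s + (1 - g n) * c @[n --> F] --> k s.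
  rewrite -[X in _ --> X]addr0 -(mul0r c); apply: cvgD; first exact: cvg_cst.
  by apply: cvgM kF _; exact: cvg_cst.
apply: (ler_cvg_to (@VF s) kl); apply: filterS piZ => n [piP opt Zn].
apply: le_trans (kc (g n) s _); last by case/andP: (g01 n) => /ltW -> ->.
rewrite ler_pM2l//; apply: (optimal_support U0 UP Urect (g01 n) B0 rB s piP pi'P opt) => //.
by move=> t a pia; apply: pi'Z; rewrite Zn inE/= pia.
Qed.

End vanishing_discount.

Theorem theorem5p1 (R : realType) (S A : pfinType) (r : S * A * S -> R)
  (U : set (S * A * S -> R)) (p0 : S -> R)
  (hp0 : simplex p0)
  (hU0 : U !=set0)
  (hU1 : U `<=` transition (S := S) (A := A))
  (hUcompact : compact (U : set {ptws (S * A * S)%type -> R}))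
  (hUdef : definable_fin U)
  (hUrect : sa_rectangular U)
  (gamma : nat -> R)
  (hgamma : forall t, 0 < gamma t < 1)
  (hgamma_incr : nondecreasing_seq gamma)
  (hgamma_lim : gamma t @[t --> \oo] --> (1 : R))
  (v : nat -> S -> R)
  (hv : forall t s,
     v t.+1 s = (1 - gamma t) * optimal_robust_value r U (gamma t) s)
  (pi : nat -> S -> A -> R)
  (hpi : forall t, (1 <= t)%N -> stationary_policy (pi t))
  (hpiv : forall t s, (1 <= t)%N ->
     (1 - gamma t.-1) * robust_value r U (gamma t.-1) (pi t) s = v t s) :
  (forall s, v t s @[t --> \oo] --> optimal_gain r U s) /\
  (\forall t \near \oo, average_optimal r U p0 (of_stationary (pi t))).
Proof.
(* [v] and [pi] at time [n] refer to the discount factor of index [n - 1]; time 0, whose predecessor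
   is 0, is left out eventually. *)
pose g n := gamma n.-1.
have gl : g n @[n --> \oo] --> (1 : R) by rewrite -cvg_shiftS.
have [B B0 rB] := finfun_bounded r.
(* Both conclusions are proved along every ultrafilter finer than [\oo]; as the limit [optimal_gain]
   is the same for all of them, [near_ultra] carries them over to [\oo]. *)
have along (F : set_system nat) : UltraFilter F -> \oo `<=` F ->
    (forall s, v n s @[n --> F] --> optimal_gain r U s) /\
    \forall n \near F, average_optimal r U p0 (of_stationary (pi n)).
  move=> FU Foo.
  have gF : g n @[n --> F] --> (1 : R) by apply: cvg_trans gl; exact: cvg_app.
  have F1 : \forall n \near F, (0 < n)%N by apply: Foo; exists 1%N.
  pose x n s := (1 - g n) * optimal_robust_value r U (g n) s.
  have vx : \forall n \near F, forall s, v n s = x n s.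
    by apply: filterS F1 => -[//|n] _ s; rewrite hv.
  have xl s : exists w : R, x n s @[n --> F] --> w.
    apply: (@ultra_cvg_bounded _ _ _ _ _ B); apply: nearW => n.
    have [Vb _] := optimal_bellman hU0 hU1 hUrect (hgamma n.-1) B0 rB.
    have k0 : 0 < 1 - g n by have /andP[_] := hgamma n.-1; rewrite subr_gt0.
    by rewrite /x normrM gtr0_norm// mulrC -ler_pdivlMr//; exact: Vb.
  have [w xw] := choice xl.
  have wU := limit_upper_value (FU := FU) hU0 hU1 hUrect (fun n => hgamma n.-1) gF xw hUcompact.
  have [Z FZ] := ultra_fin F (fun n => [set y | pi n y.1 y.2 == 0]%SET).
  have piZ : \forall n \near F, [/\ stationary_policy (pi n),
      forall s, robust_value r U (g n) (pi n) s = optimal_robust_value r U (g n) s &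
      Z = [set y | pi n y.1 y.2 == 0]%SET].
    near=> n; have n0 : (0 < n)%N by near: n.
    split; [exact: hpi| |by apply/esym; near: n].
    move=> s; have k0 : 1 - g n != 0.
      by have /andP[_] := hgamma n.-1; rewrite -subr_gt0 => /lt0r_neq0.
    apply: (mulfI k0); rewrite hpiv//.
    have -> : v n s = x n s by move: s; near: n.
    by [].
  have sec := limit_secures (FU := FU) hU0 hU1 hUrect (fun n => hgamma n.-1) gF xw piZ.
  have piO : \forall n \near F, average_optimal r U p0 (of_stationary (pi n)).
    apply: filterS piZ => n [piP _ Zn]; apply: (secures_average_optimal hU0 hU1 wU _ hp0).
    (* [pi n] itself vanishes on [Z], so [sec] covers it. *)
    by apply: sec => // s a; rewrite Zn inE => /eqP.
  split=> // s; have [m [mP _ Zm]] := filter_ex piZ.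
  (* Each row of [pi m] sums to 1, so every state has a played action; choosing one per state gives
     a deterministic policy that avoids [Z]. *)
  have supp t : exists a, (t, a) \notin Z.
    apply: contrapT => /forallNP no; have := (mP t).2.
    rewrite big1 => [/eqP|a _]; first by rewrite eq_sym oner_eq0.
    by have /negP := no a; rewrite negbK Zm inE => /eqP.
  have [d dZ] := choice supp.
  rewrite (@secures_optimal_gain _ _ _ r U hU0 hU1 w d)//.
    by apply: cvg_trans (xw s); apply: near_eq_cvg; apply: filterS vx => n ->.
  apply: sec; first exact: of_deterministicP.
  move=> t a ta; rewrite /of_deterministic; case: eqP => // ad.
  by move: (dZ t); rewrite -ad ta.
split; last by apply: near_ultra => F FU Foo; have [] := along F FU Foo.
move=> s; apply/cvgrPdist_le => e e0; apply: near_ultra => F FU Foo.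
by have [/(_ s)/cvgrPdist_le/(_ e e0)] := along F FU Foo.
Unshelve. all: by end_near.
Qed.
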